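(* (i) The regular dodecahedron in $\mathbb{R}^3$ that circumscribes a sphere of diameter $1$ is not a universal cover. (ii) The dual of the $3_{21}$ polytope in $\mathbb{R}^7$ that circumscribes a sphere of diameter $1$ is not a universal cover. The polytope in $\mathbb{R}^{23}$ that circumscribes a sphere of diameter $1$, whose facets are normal to the vectors of an orbit of $552$ vectors of the Conway group $\mathrm{Co}_3$, is also not a universal cover.
   Context: A convex set $K\subset\mathbb{R}^d$ is a universal cover if for every set $X\subset\mathbb{R}^d$ of diameter $1$ there exist $A\in O(d)$ and $b\in\mathbb{R}^d$ such that $X\subset A(K)+b$. For nonzero vectors $v_1,\dots,v_n$ spanning $\mathbb{R}^d$, write $K^d(v_1,\dots,v_n)=\{x\in\mathbb{R}^d:\ |\langle x,v_i\rangle|\le\frac12\|v_i\|\text{ for all }i\}$; this is the polytope circumscribing the sphere of diameter $1$ centered at $0$ whose facets have normals $\pm v_1,\dots,\pm v_n$. The regular dodecahedron of (i) is $K^3(v_1,\dots,v_6)$ where $\pm v_1,\dots,\pm v_6$ are the vertices of a regular icosahedron centered at $0$. The $3_{21}$ polytope: let $u=\sum_{i=1}^8e_i\in\mathbb{R}^8$ and $v_{ij}=u-4(e_i+e_j)$ for $1\le i<j\le 8$. The $56$ vertices of the $3_{21}$ polytope are $\pm v_{ij}/\sqrt{24}$, in the hyperplane $u^\perp\cong\mathbb{R}^7$. The polytope in (ii) is $K^7$ of the $28$ vectors $v_{ij}$ (in $u^\perp\cong\mathbb{R}^7$). The $552$ vectors in $\mathbb{R}^{23}$: let $\Lambda\subset\mathbb{R}^{24}$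 be the Leech lattice, normalized to be even unimodular with minimal squared norm $4$, in its standard coordinates; let $x=(4e_1+\sum_{i=1}^{24}e_i)/\sqrt8\in\Lambda$, so $\|x\|^2=6$. There are exactly $552$ vectors $u\in\Lambda$ with $\|u\|^2=4$ and $\langle u,x\rangle=3$. Their projections $u-\frac x2$ to $x^\perp\cong\mathbb{R}^{23}$ form a centrally symmetric set of $552$ vectors $\pm v_1,\dots,\pm v_{276}$, which is an orbit of $\mathrm{Co}_3$ (the stabilizer of $x$ in the automorphism group of $\Lambda$). The second polytope in (ii) is $K^{23}(v_1,\dots,v_{276})$. *)

(* Defs.v *)
From HB Require Import structures.
From mathcomp Require Import all_boot all_order all_algebra.
From mathcomp Require Import classical_sets reals constructive_ereal ereal.
From mathcomp Require Import interval_inference convex.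
From mathcomp Require Import ring lra.

Set Implicit Arguments.
Unset Strict Implicit.
Unset Printing Implicit Defensive.

Import Order.TTheory GRing.Theory Num.Theory.

Local Open Scope classical_set_scope.
Local Open Scope ring_scope.

(* The norm that the libraries attach to matrices is the sup norm, so the
   Euclidean structure on 'cV[R]_d has to be introduced here. *)
Definition dot (R : realType) (d : nat) (x y : 'cV[R]_d) : R :=
  \sum_i x i 0 * y i 0.

Definition enorm (R : realType) (d : nat) (x : 'cV[R]_d) : R :=
  Num.sqrt (dot x x).

Definition diameter (R : realType) (d : nat) (X : set 'cV[R]_d) : \bar R :=
  ereal_sup [set (enorm (x - y))%:E | x in X & y in X].

Definition orthogonal (R : realType) (d : nat) (A : 'M[R]_d) : Prop :=
  A^T *m A = 1%:M.

Definition universal_cover (R : realType) (d : nat) (K : set 'cV[R]_d) : Prop :=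
  convex_set K /\
  forall X : set 'cV[R]_d, diameter X = 1%:E ->
    exists (A : 'M[R]_d) (b : 'cV[R]_d),
      orthogonal A /\ X `<=` [set A *m x + b | x in K].

(* K^d(v_1, ..., v_n), where V is the set of the v_i. Neither replacing a v_i
   by its opposite nor adding the opposites to V changes it. *)
Definition circumscribed (R : realType) (d : nat) (V : set 'cV[R]_d) :
    set 'cV[R]_d :=
  [set x | forall v, V v -> `|dot x v| <= enorm v / 2].

(* The index i + 1 is taken modulo 3: the vertices are the cyclic
   permutations of (0, +-1, +-phi), with phi the golden ratio. *)
Definition icosahedron (R : realType) : set 'cV[R]_3 :=
  [set p | exists i : 'I_3,
    [/\ p i 0 = 0, `|p (i + 1) 0| = 1
      & `|p (i + 2) 0| = (1 + Num.sqrt 5) / 2]].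
Arguments icosahedron R : clear implicits.

Definition regular_icosahedron (R : realType) (V : set 'cV[R]_3) : Prop :=
  exists (c : R) (A : 'M[R]_3),
    [/\ 0 < c, orthogonal A & V = [set c *: (A *m p) | p in icosahedron R]].

(* For x <> 0, such a B restricts to a linear isometry from the hyperplane
   orthogonal to x onto R^d, and every such isometry arises in this way from
   exactly one B. *)
Definition perp_isometry (R : realType) (d : nat) (x : 'cV[R]_d.+1)
    (B : 'M[R]_(d, d.+1)) : Prop :=
  B *m B^T = 1%:M /\ B *m x = 0.

Definition u8 (R : realType) : 'cV[R]_8 := const_mx 1.

Definition v8 (R : realType) (i j : 'I_8) : 'cV[R]_8 :=
  u8 R - 4 *: (delta_mx i 0 + delta_mx j 0).

Definition axes321 (R : realType) : set 'cV[R]_8 :=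
  [set v8 R ij.1 ij.2 | ij in [set ij : 'I_8 * 'I_8 | (ij.1 < ij.2)%N]].
Arguments axes321 R : clear implicits.

(* Generator matrix of the extended binary Golay code, as the extension by a
   parity bit of the cyclic code of length 23 with generator polynomial
   1 + X^2 + X^4 + X^5 + X^6 + X^10 + X^11 (the quadratic residue code). *)
Definition golay_gen : 'M['F_2]_(12, 24) :=
  \matrix_(i, j) (if (j == 23 :> nat) then true
    else (i <= j)%N && ((j - i)%N \in [:: 0; 2; 4; 5; 6; 10; 11]%N))%:R.

Definition golay (c : 'rV['F_2]_24) : bool := (c <= golay_gen)%MS.

(* The vectors (2 c + 4 w) / sqrt 8 with even coordinate sum of w and
   (1 + 2 c + 4 w) / sqrt 8 with odd coordinate sum of w, for c a word of the
   Golay code (lifted to {0, 1}) and w an integer vector. *)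
Definition leech (R : realType) : set 'cV[R]_24 :=
  [set y | exists (m : bool) (c : 'rV['F_2]_24) (w : 'cV[int]_24),
    [/\ golay c, odd `|(\sum_i w i 0)%R|%N = m
      & y = (Num.sqrt 8)^-1 *:
          \col_i (m%:R + 2 * (nat_of_ord (c 0 i))%:R + 4 * (w i 0)%:~R)]].
Arguments leech R : clear implicits.

Definition x24 (R : realType) : 'cV[R]_24 :=
  (Num.sqrt 8)^-1 *: (4 *: delta_mx ord0 0 + const_mx 1).

Definition orbit552 (R : realType) : set 'cV[R]_24 :=
  [set u - 2^-1 *: x24 R | u in
    [set u | [/\ leech R u, enorm u ^+ 2 = 4 & dot u (x24 R) = 3]]].
Arguments orbit552 R : clear implicits.

Lemma circumscribed_convex (R : realType) (d : nat) (V : set 'cV[R]_d) :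
  convex_set (circumscribed V).
Proof.
move=> x y t; rewrite !inE => Kx Ky v Vv.
have -> : dot (conv t x y) v = t%:num * dot x v + (1 - t%:num) * dot y v.
  rewrite /dot !mulr_sumr -big_split /=; apply: eq_bigr => i _.
  by rewrite !mxE mulrDl !mulrA.
have t0 : 0 <= t%:num by [].
have t1 : t%:num <= 1 by [].
move: (Kx v Vv) (Ky v Vv); rewrite !ler_norml => /andP[a b] /andP[c e].
apply/andP; split; nra.
Qed.

Lemma perp_isometry_exists (R : realType) (d : nat) (x : 'cV[R]_d.+1) :
  exists B, perp_isometry x B.
Proof.
suff [H [HH Hx]] : exists H : 'M[R]_(1 + d),
    H *m H^T = 1%:M /\ dsubmx (H *m x) = 0.
  exists (dsubmx H); split; last by rewrite -mul_dsub_mx in Hx.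
  move: HH; rewrite -{1 2}(vsubmxK H) tr_col_mx mul_col_row scalar_mx_block.
  by case/eq_block_mx.
pose e : 'cV[R]_(1 + d) := enorm x *: delta_mx ord0 0.
have dsube : dsubmx e = 0.
  by apply/matrixP => i j; rewrite !mxE ord1 -[_ == _]/(false) /= mulr0.
have [xe|xe] := eqVneq x e.
  by exists 1%:M; rewrite trmx1 !mul1mx xe.
pose w := x - e.
have dotmx (a b : 'cV[R]_(1 + d)) : a^T *m b = (dot a b)%:M.
  apply/matrixP => i j; rewrite !ord1 !mxE; apply: eq_bigr => k _.
  by rewrite !mxE.
have dotge (a : 'cV[R]_(1 + d)) : 0 <= dot a a.
  by apply: sumr_ge0 => i _; rewrite -expr2 sqr_ge0.
have dw0 : dot w w != 0.
  apply: contra_neq xe => /eqP.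
  rewrite psumr_eq0 => [/allP h|i _]; last by rewrite -expr2 sqr_ge0.
  apply/eqP; rewrite -subr_eq0; apply/eqP/matrixP => i j.
  have := h i (mem_index_enum _); rewrite !ord1 -expr2 sqrf_eq0 => /eqP.
  by move=> ->; rewrite mxE.
have dB (a b c : 'cV[R]_(1 + d)) : dot a (b - c) = dot a b - dot a c.
  by rewrite -sumrB; apply: eq_bigr => i _; rewrite !mxE mulrBr.
have dC (a b : 'cV[R]_(1 + d)) : dot a b = dot b a.
  by apply: eq_bigr => i _; rewrite mulrC.
have dee : dot e e = dot x x.
  rewrite /dot (bigD1 ord0) //= big1 ?addr0.
    by rewrite !mxE !eqxx mulr1 -expr2 sqr_sqrtr.
  by move=> i /negbTE i0; rewrite !mxE i0 mulr0 mul0r.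
have dwx : 2 * dot w x = dot w w.
  have -> : dot w w = dot w x - dot w e by rewrite -dB.
  rewrite mulrDl mul1r; congr (_ + _).
  by rewrite dC (dC w e) !dB dee (dC e x) opprB.
pose H := 1%:M - (2 / dot w w) *: (w *m w^T).
exists H; split.
  have HT : H^T = H by rewrite /H linearB linearZ /= trmx1 trmx_mul trmxK.
  rewrite HT /H mulmxBl mul1mx mulmxBr mulmx1 -scalemxAl -scalemxAr.
  rewrite mulmxA -(mulmxA w) dotmx mul_mx_scalar -scalemxAl !scalerA.
  rewrite -mulrA divfK // -addrA -opprD addrA -scalerDl -scalerBl.
  by rewrite (mulrC _^-1) [2 * (_ / _)]mulr_natl mulr2n addrN scale0r subr0.
suff -> : H *m x = e by [].
rewrite /H mulmxBl mul1mx -scalemxAl -mulmxA dotmx mul_mx_scalar scalerA.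
have -> : 2 / dot w w * dot w x = 1 by rewrite mulrAC dwx divff.
by rewrite scale1r /w opprB addrC subrK.
Qed.

(* Main.v *)
(* Let [f] be a cubic form on R^d. For small [e > 0] the points
   [w / 2 + e (grad f w - 2 f(w) w)], for [w] a unit vector, form a set of
   diameter 1 whose supporting value in the direction [w] is [1 / 2 + e f(w)].
   If it is covered by a copy of [K^d(V)], then on the unit normals of that
   copy the odd function [f] coincides with a linear functional. It is therefore
   enough to find [f] that is linear on no rotated copy of [V].

   In all three cases [V] consists of d (d + 1) / 2 equiangular lines [w_i],
   scaled here to squared norm d + 2. Their squares [w_i w_i^T] form a basis of
   the symmetric matrices, hence the moments of [V] of order 2 and 4 are those
   of the sphere, with total mass N' = (d + 1) (d + 2) / 2, and the linear
   functional has to be the orthogonal projection of [f].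

   For the icosahedron [f = x_0 ^ 3] works: linearity means [X ^ 3 = 3 X] for
   the coordinates [X] of the [w_i], so every [X ^ 2] is 0 or 3, but their sum
   is N' = 10.

   For d = 7, 23 one takes, for dl << mu << ep << 1,
     [f = U ^ 3 + dl (U S ^ 2 + mu (S ^ 3 + ep S ^ 2 X))]
   in three orthogonal coordinates, [U] being scaled by [1 / sqrt 3]. Linearity
   of the leading term gives [U ^ 3 = U] up to O(dl); as the Gram matrix is
   integral, [U] is close to a linear functional [u] with values 0, 1, -1.
   Where [u <> 0], the next term gives [S ^ 2 = 1] approximately. Where
   [u = 0], what remains is that [S ^ 3 + ep S ^ 2 X] is nearly linear,
   and the moments turn this into [S ^ 3 - 4 S + ep (S ^ 2 - 1) X = 0]
   approximately. There [S] is also a combination with fixed rational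
   coefficients of its values where [u <> 0], which are close to 1 or -1; so
   [S] is extremely close to 0, 2 or -2, and [X] is close to 0. This
   contradicts the moments of order 2 and 4, which give the sum of [X ^ 2]
   over [u = 0]. *)

Require Import Defs.
From mathcomp Require Import all_boot all_order all_algebra.
From mathcomp Require Import classical_sets reals constructive_ereal ereal.
From mathcomp Require Import ring lra zify.

Set Implicit Arguments.
Unset Strict Implicit.
Unset Printing Implicit Defensive.

Import Order.TTheory GRing.Theory Num.Theory.

Local Open Scope classical_set_scope.
Local Open Scope ring_scope.

(** * The Euclidean product and cubic forms *)

Section Dot.
Variables (R : realType) (d : nat).
Implicit Types (x y z : 'cV[R]_d) (a : R) (A : 'M[R]_d).

Lemma dotC x y : dot x y = dot y x.
Proof. by apply: eq_bigr => i _; rewrite mulrC. Qed.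

Lemma dotDl x y z : dot (x + y) z = dot x z + dot y z.
Proof. by rewrite -big_split; apply: eq_bigr => i _; rewrite mxE mulrDl. Qed.

Lemma dotDr x y z : dot z (x + y) = dot z x + dot z y.
Proof. by rewrite !(dotC z) dotDl. Qed.

Lemma dotZl a x y : dot (a *: x) y = a * dot x y.
Proof. by rewrite mulr_sumr; apply: eq_bigr => i _; rewrite mxE mulrA. Qed.

Lemma dotZr a x y : dot x (a *: y) = a * dot x y.
Proof. by rewrite dotC dotZl dotC. Qed.

Lemma dotNl x y : dot (- x) y = - dot x y.
Proof. by rewrite -scaleN1r dotZl mulN1r. Qed.

Lemma dotNr x y : dot x (- y) = - dot x y.
Proof. by rewrite dotC dotNl dotC. Qed.

Lemma dotBl x y z : dot (x - y) z = dot x z - dot y z.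
Proof. by rewrite dotDl dotNl. Qed.

Lemma dotBr x y z : dot z (x - y) = dot z x - dot z y.
Proof. by rewrite dotDr dotNr. Qed.

Lemma dot0l x : dot 0 x = 0.
Proof. by rewrite -(scale0r x) dotZl mul0r. Qed.

Lemma dot_suml (I : Type) (s : seq I) (P : pred I) (F : I -> 'cV[R]_d) x :
  dot (\sum_(i <- s | P i) F i) x = \sum_(i <- s | P i) dot (F i) x.
Proof.
elim/big_rec2: _ => [|i a b _ <-]; first by rewrite dot0l.
by rewrite dotDl.
Qed.

Lemma dot_delta x i : dot x (delta_mx i 0) = x i 0.
Proof.
rewrite /dot (bigD1 i) //= big1 ?addr0 => [|j /negbTE ji].
  by rewrite !mxE !eqxx mulr1.
by rewrite !mxE ji mulr0.
Qed.

Lemma dot_mulmx m (A : 'M[R]_(d, m)) (u : 'cV[R]_m) x :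
  dot (A *m u) x = dot u (A^T *m x).
Proof.
rewrite /dot.
under eq_bigr => i _ do rewrite mxE mulr_suml.
rewrite exchange_big; apply: eq_bigr => j _; rewrite mxE mulr_sumr.
by apply: eq_bigr => i _; rewrite mxE mulrCA mulrA.
Qed.

Lemma dotxx_ge0 x : 0 <= dot x x.
Proof. by apply: sumr_ge0 => i _; rewrite -expr2 sqr_ge0. Qed.

Lemma dotxx_eq0 x : dot x x = 0 -> x = 0.
Proof.
move/eqP; rewrite psumr_eq0 => [/allP h|i _]; last by rewrite -expr2 sqr_ge0.
apply/matrixP => i j; have := h i (mem_index_enum _).
by rewrite !ord1 -expr2 sqrf_eq0 mxE => /eqP.
Qed.

Lemma dot_CauchySchwarz x y : dot x y ^+ 2 <= dot x x * dot y y.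
Proof.
have [/dotxx_eq0 ->|y0] := eqVneq (dot y y) 0.
  by rewrite (dotC x) !dot0l mulr0 expr0n.
have yp : 0 < dot y y by rewrite lt_neqAle eq_sym y0 dotxx_ge0.
have := dotxx_ge0 (dot y y *: x - dot x y *: y).
rewrite !(dotBl, dotBr, dotZl, dotZr) (dotC y x).
set a := dot x x; set b := dot y y in yp *; set c := dot x y => h.
have {}h : 0 <= b * (a * b - c ^+ 2) by move: h; congr (_ <= _); ring.
by move: h; rewrite pmulr_rge0 // subr_ge0.
Qed.

Lemma dot_orthogonal A x y : Defs.orthogonal A -> dot (A *m x) (A *m y) = dot x y.
Proof. by move=> AA; rewrite dot_mulmx mulmxA AA mul1mx. Qed.

Lemma enorm_sqr x : enorm x ^+ 2 = dot x x.
Proof. by rewrite sqr_sqrtr ?dotxx_ge0. Qed.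

Lemma enorm_ge0 x : 0 <= enorm x.
Proof. exact: sqrtr_ge0. Qed.

End Dot.

(** * Cubic forms, their gradients and a one-sided Taylor estimate on the sphere *)

Section Cubic.
Variables (R : realType) (d : nat) (c : 'M[R]_d).
Implicit Types (x u w : 'cV[R]_d).

Definition cubic x : R := \sum_i \sum_j c i j * (x i 0 * x j 0 ^+ 2).

Definition grad x : 'cV[R]_d :=
  \col_k (\sum_j c k j * x j 0 ^+ 2 + \sum_i c i k * (2 * x i 0 * x k 0)).

Lemma dot_grad x u : dot (grad x) u =
  \sum_i \sum_j c i j * (u i 0 * x j 0 ^+ 2 + 2 * x i 0 * x j 0 * u j 0).
Proof.
transitivity (\sum_k \sum_j c k j * x j 0 ^+ 2 * u k 0 +
              \sum_k \sum_i c i k * (2 * x i 0 * x k 0) * u k 0).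
  rewrite -big_split; apply: eq_bigr => k _.
  by rewrite mxE mulrDl !mulr_suml.
rewrite [X in _ + X]exchange_big -big_split; apply: eq_bigr => i _ /=.
by rewrite -big_split; apply: eq_bigr => j _ /=; ring.
Qed.

Lemma cubicN x : cubic (- x) = - cubic x.
Proof.
rewrite -sumrN; apply: eq_bigr => i _; rewrite -sumrN; apply: eq_bigr => j _.
by rewrite !mxE; ring.
Qed.

Lemma cubicZ a x : cubic (a *: x) = a ^+ 3 * cubic x.
Proof.
rewrite mulr_sumr; apply: eq_bigr => i _; rewrite mulr_sumr.
by apply: eq_bigr => j _; rewrite !mxE; ring.
Qed.

Lemma gradN x : grad (- x) = grad x.
Proof.
apply/matrixP => k j; rewrite !mxE; congr (_ + _).
  by apply: eq_bigr => i _; rewrite !mxE; ring.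
by apply: eq_bigr => i _; rewrite !mxE; ring.
Qed.

Lemma grad_Euler x : dot (grad x) x = 3 * cubic x.
Proof.
rewrite dot_grad mulr_sumr; apply: eq_bigr => i _; rewrite mulr_sumr.
by apply: eq_bigr => j _; ring.
Qed.

(** One constant bounds both the form on the unit sphere and its Taylor remainder; the factor 4
    comes from the remainder. *)
Definition cubic_bound : R := \sum_i \sum_j `|c i j| * 4.

Lemma cubic_bound_ge0 : 0 <= cubic_bound.
Proof. by apply: sumr_ge0 => i _; apply: sumr_ge0 => j _; exact: mulr_ge0. Qed.

Lemma coord_le x i : x i 0 ^+ 2 <= dot x x.
Proof.
rewrite /dot (bigD1 i) //= -expr2 lerDl.
by apply: sumr_ge0 => j _; rewrite -expr2 sqr_ge0.
Qed.

Lemma unit_coord x i : dot x x = 1 -> -1 <= x i 0 <= 1.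
Proof. by move=> x1; rewrite -ler_norml -(@ler_pXn2r _ 2) ?nnegrE // real_normK
  ?num_real // expr1n -x1 coord_le. Qed.

Lemma ler_coefM (a b : R) : `|a| <= b -> forall k, k * a <= `|k| * b.
Proof.
move=> ab k; apply: le_trans (ler_norm _) _.
by rewrite normrM ler_wpM2l.
Qed.

Lemma cubic_le x : dot x x = 1 -> cubic x <= cubic_bound.
Proof.
move=> x1; apply: ler_sum => i _; apply: ler_sum => j _; apply: ler_coefM.
rewrite normrM normrX.
have := unit_coord i x1; have := unit_coord j x1; rewrite -!ler_norml => hj hi.
have := normr_ge0 (x i 0); have := normr_ge0 (x j 0) => ? ?; nra.
Qed.

(** By Euler's identity the first-order expansion at [x], evaluated at [u], is
    [<grad f(x), u> - 2 f(x)]. The remainder is bounded monomial by monomial. *)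
Lemma cubic_remainder x u : dot x x = 1 -> dot u u = 1 ->
  dot (grad x) u - 2 * cubic x - cubic u <= cubic_bound * dot (u - x) (u - x).
Proof.
move=> x1 u1; rewrite /cubic_bound mulr_suml dot_grad.
rewrite mulr_sumr -!sumrB; apply: ler_sum => i _.
rewrite mulr_suml mulr_sumr -!sumrB; apply: ler_sum => j _.
set r := (X in _ <= X); set k := c i j.
have -> : r = `|k| * (4 * dot (u - x) (u - x)) by rewrite /r mulrA.
rewrite (mulrCA 2 k) -!mulrBr; apply: ler_coefM; rewrite {r}.
have := coord_le (u - x) i; have := coord_le (u - x) j.
move: (dot _ _) => D; rewrite !mxE.
have /andP[] := unit_coord i x1; have /andP[] := unit_coord j x1.
have /andP[] := unit_coord i u1; have /andP[] := unit_coord j u1.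
move: (x i 0) (x j 0) (u i 0) (u j 0) => a b a' b' h1 h2 h3 h4 h5 h6 h7 h8 h9 h10.
(* Factored this way, the remainder is visibly quadratic in [u - x]; its two terms are bounded by
   [D] and [3 * D]. *)
have -> : a' * b ^+ 2 + 2 * a * b * b' - 2 * (a * b ^+ 2) - a' * b' ^+ 2 =
  - ((b' - b) * (a' * (b' - b) + 2 * b * (a' - a))) by ring.
rewrite ler_norml.
set p := b' - b in h9 *; set q := a' - a in h10 *.
have e1 : - D <= a' * p ^+ 2 <= D by have ? := sqr_ge0 p; apply/andP; split; nra.
have e2 : - (3 * D) <= 2 * b * p * q <= 3 * D.
  have e3 : - D <= p * q <= D.
    by have ? := sqr_ge0 (p + q); have ? := sqr_ge0 (p - q); apply/andP; split; nra.
  have -> : 2 * b * p * q = 2 * (b * (p * q)) by ring.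
  move: (p * q) e3 => t /andP[e3 e4]; apply/andP; split; nra.
move: e1 e2 => /andP[e1 e1'] /andP[e2 e2'].
by apply/andP; split; lra.
Qed.

End Cubic.

(** * Perturbations of the ball *)

Section PerturbedBall.
Variables (R : realType) (d : nat) (c : 'M[R]_d.+1).
Implicit Types (x y u w b : 'cV[R]_d.+1) (V : set 'cV[R]_d.+1).

Let e : R := (1 + 8 * cubic_bound c)^-1.

Let e_gt0 : 0 < e.
Proof. by rewrite invr_gt0; have := cubic_bound_ge0 c; lra. Qed.

Let e_small : e * (8 * cubic_bound c) <= 1.
Proof.
have ? := cubic_bound_ge0 c.
by rewrite mulrC ler_pdivrMr; lra.
Qed.

(** The gradient at the unit vector [w] of [|x| / 2 + e f(x) / |x| ^ 2], the extension of degree 1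
    of the support function [1 / 2 + e f]. Hence it is the contact point of the supporting
    hyperplane with normal [w]. *)
Definition touch w : 'cV[R]_d.+1 :=
  2^-1 *: w + e *: (grad c w - (2 * cubic c w) *: w).

Definition perturbed_ball : set 'cV[R]_d.+1 :=
  [set touch w | w in [set w | dot w w = 1]].

Lemma dot_touch w : dot w w = 1 -> dot (touch w) w = 2^-1 + e * cubic c w.
Proof.
move=> w1; rewrite dotDl !dotZl dotBl dotZl grad_Euler w1; ring.
Qed.

(** The ball leaves a margin [(1 - <w, u>) / 2], a multiple of [|u - w| ^ 2]; since
    [4 * e * cubic_bound c <= 1 / 2], it absorbs the Taylor remainder. *)
Lemma dot_touch_le w u : dot w w = 1 -> dot u u = 1 ->
  dot (touch w) u <= 2^-1 + e * cubic c u.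
Proof.
move=> w1 u1; rewrite dotDl !dotZl dotBl dotZl.
have := cubic_remainder c w1 u1; have := cubic_le c w1.
rewrite !(dotBl, dotBr) w1 u1 (dotC u w).
have k1 : dot w u <= 1.
  by have := dotxx_ge0 (w - u); rewrite !(dotBl, dotBr) w1 u1 (dotC u w); lra.
move: (dot w u) (dot (grad c w) u) (cubic c w) (cubic c u) k1.
move=> k g f f' k1 fC gC.
have {fC gC} h : g - 2 * f * k - f' <= 4 * cubic_bound c * (1 - k) by nra.
by have := e_gt0; have := e_small; nra.
Qed.

(** Constant width: the form is odd, so the support values in opposite directions add up to 1. *)
Lemma diameter_perturbed_ball : diameter perturbed_ball = 1%:E.
Proof.
apply/eqP; rewrite eq_le; apply/andP; split.
  apply: ge_ereal_sup => _ [_ [w w1 <-] [_ [w' w1' <-] <-]].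
  rewrite lee_fin; set y := touch w - touch w'.
  have [y0|y0] := eqVneq (enorm y) 0; first by rewrite y0.
  have yp : 0 < enorm y by rewrite lt_neqAle eq_sym y0 enorm_ge0.
  pose n := (enorm y)^-1 *: y.
  have n1 : dot n n = 1.
    by rewrite dotZl dotZr -enorm_sqr; field.
  have n1' : dot (- n) (- n) = 1 by rewrite dotNl dotNr opprK.
  have -> : enorm y = dot y n.
    by rewrite dotZr -enorm_sqr; field.
  have := dot_touch_le w1 n1; have := dot_touch_le w1' n1'.
  by rewrite cubicN dotNr dotBl; lra.
apply: ereal_sup_ubound.
pose w : 'cV[R]_d.+1 := delta_mx 0 0.
have w1 : dot w w = 1 by rewrite dot_delta mxE !eqxx.
exists (touch w); first by exists w.
exists (touch (- w)).
  by exists (- w) => //=; rewrite dotNl dotNr opprK.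
congr _%:E; have -> : touch w - touch (- w) = w.
  rewrite /touch gradN cubicN; by apply/matrixP => i j; rewrite !mxE; field.

by rewrite /enorm w1 sqrtr1.
Qed.

(** Each pair of opposite facets bounds a slab of width 1, the width of the covered set. The
    inequality between support values holds for both unit normals, and oddness turns the two into an
    equality. The factor [dot v v] makes both sides homogeneous of degree 3. *)
Lemma cover_cubic V : universal_cover (circumscribed V) ->
  exists A b, Defs.orthogonal A /\
    forall v, V v -> cubic c (A *m v) = dot v v * dot v b.
Proof.
case=> _ /(_ _ diameter_perturbed_ball) [A [b [AA XK]]].
exists A, (e^-1 *: (A^T *m b)); split=> // v Vv.
have [/dotxx_eq0 v0|v0] := eqVneq (dot v v) 0.
  rewrite v0 mulmx0 !dot0l mul0r -(scale0r (0 : 'cV[R]_d.+1)) cubicZ.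
  by rewrite expr0n mul0r.
have nv : enorm v != 0.
  by apply: contra_neq v0 => h; rewrite -enorm_sqr h expr0n.
have nvp : 0 < enorm v by rewrite lt_neqAle eq_sym nv enorm_ge0.
(* The sign [s] selects one of the two opposite unit normals of the rotated slab. *)
pose w s := (s / enorm v) *: (A *m v).
have w1 s : s ^+ 2 = 1 -> dot (w s) (w s) = 1.
  move=> s1; rewrite dotZl dotZr dot_orthogonal // -enorm_sqr.
  by rewrite -s1; field.
have wle s : s ^+ 2 = 1 -> e * cubic c (w s) <= dot (w s) b.
  move=> s1; have [k Kk kE] := XK (touch (w s)) (ex_intro2 _ _ (w s) (w1 s s1)
    erefl).
  have := dot_touch (w1 s s1); rewrite -kE dotDl (dotC b).
  have -> : dot (A *m k) (w s) = s / enorm v * dot k v.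
    by rewrite dotZr dot_orthogonal.
  have : s / enorm v * dot k v <= 2^-1.
    have /(_ v Vv) := Kk; rewrite ler_norml => /andP[k1 k2].
    rewrite mulrAC ler_pdivrMr //.
    have /eqP : (s - 1) * (s + 1) = 0 by move: s1; rewrite expr2 => s1; lra.
    rewrite mulf_eq0 => /orP[] /eqP ss.
      by rewrite (_ : s = 1); lra.
    by rewrite (_ : s = -1); lra.
  lra.
have := wle 1 (expr1n _ _); have := wle (-1) (etrans (sqrrN 1) (expr1n _ _)).
rewrite /w !cubicZ !dotZl dot_mulmx dotZr; set t := dot v (A^T *m b).
move: (cubic c (A *m v)) => g; rewrite -enorm_sqr;
  move: (enorm v) nv nvp => s s0 sp.
rewrite !mulN1r !div1r => h1 h2.
have h : e * ((s^-1) ^+ 3 * g) = s^-1 * t by move: h1 h2; lra.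
apply: (mulfI (lt0r_neq0 e_gt0)); apply: (mulfI (expf_neq0 3 (invr_neq0 s0))).
rewrite mulrCA h; move: (e) (lt0r_neq0 e_gt0) => e1 e1_neq0.
by field; rewrite s0 e1_neq0.
Qed.

End PerturbedBall.

(** * Equiangular lines and designs *)

Lemma card_pairs_leq d : (#|[pred p : 'I_d * 'I_d | p.1 <=
  p.2]%N| * 2 = d * d.+1)%N.
Proof.
rewrite -sum1_card -(pair_big_dep xpredT (fun i j : 'I_d =>
  i <= j)%N (fun _ _ => 1%N)) /=.
rewrite (exchange_big_dep xpredT) //=.
under eq_bigr => j _.
  rewrite -(big_ord_widen d (fun=> 1%N) (ltn_ord j)) sum_nat_const card_ord muln1.
  over.
elim: d => [|d IHd]; first by rewrite big_ord0.
by rewrite big_ord_recr /= mulnDl IHd; lia.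
Qed.

Lemma card_pairs_ltn d : (#|[pred p : 'I_d.+1 * 'I_d.+1 | p.1 < p.2]%N| * 2 = d *
  d.+1)%N.
Proof.
rewrite -sum1_card -(pair_big_dep xpredT (fun i j : 'I_d.+1 =>
  i < j)%N (fun _ _ => 1%N)) /=.
rewrite (exchange_big_dep xpredT) //=.
under eq_bigr => j _.
  rewrite -(big_ord_widen d.+1 (fun=> 1%N) (ltnW (ltn_ord j))) sum_nat_const
    card_ord muln1.
  over.
elim: d => [|d IHd]; first by rewrite big_ord_recr big_ord0.
by rewrite big_ord_recr /= mulnDl IHd; lia.
Qed.

Section EquiangularDesign.
Variables (R : realType) (d : nat) (I : finType) (w : I -> 'cV[R]_d).
Hypothesis cardI : (#|I| * 2 = d * d.+1)%N.
Hypothesis dotww : forall i, dot (w i) (w i) = d%:R + 2.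
Hypothesis dotww' : forall i j, i != j -> dot (w i) (w j) ^+ 2 = d%:R + 2.
Implicit Types (x y z t : 'cV[R]_d).

(** Equal to [(d + 2) ^ 2 - (d + 2)], the gap between diagonal and off-diagonal entries in the Gram
    matrix of the squares [w_i w_i^T]. *)
Let a : R := (d%:R + 1) * (d%:R + 2).

Let a_neq0 : a != 0.
Proof. by rewrite mulf_neq0 // natr1 -?(natrD _ _ 2) ?pnatr_eq0 ?addn2. Qed.

Let P := {p : 'I_d * 'I_d | (p.1 <= p.2)%N}.

(** Each row is the upper triangle of some [w_i w_i^T]; by [cardI] the matrix is square. *)
Let sq : 'M[R]_(#|I|, #|{: P}|) :=
  \matrix_(k, l) (w (enum_val k) (val (enum_val l)).1 0 *
                  w (enum_val k) (val (enum_val l)).2 0).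

Let dot_sum_sq (c : I -> R) j :
  \sum_i c i * dot (w i) (w j) ^+ 2 = a * c j + (d%:R + 2) * \sum_i c i.
Proof.
rewrite (bigD1 j) //= [in RHS](bigD1 j) //= dotww.
rewrite (eq_bigr (fun i => (d%:R + 2) * c i)) => [|i ij]; last first.
  by rewrite dotww' // mulrC.
by rewrite -mulr_sumr /a; ring.
Qed.

Let dot_prod_sum (c : I -> R) (Q : 'M[R]_d) :
  (forall k l : 'I_d, (k <= l)%N -> \sum_i c i * (w i k 0 * w i l 0) = Q k l) ->
  Q^T = Q ->
  forall x y, \sum_i c i * (dot (w i) x * dot (w i) y) =
              \sum_k \sum_l Q k l * (x k 0 * y l 0).
Proof.
move=> cQ Qs x y.
have {}cQ (k l : 'I_d) : \sum_i c i * (w i k 0 * w i l 0) = Q k l.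
  have [|/ltnW] := leqP k l; first exact: cQ.
  move=> /cQ; rewrite -[in RHS]Qs mxE => <-.
  by apply: eq_bigr => i _; rewrite (mulrC (w i k 0)).
under [RHS]eq_bigr => k _ do under eq_bigr => l _ do rewrite -cQ mulr_suml.
under [RHS]eq_bigr => k _ do rewrite exchange_big.
rewrite exchange_big; apply: eq_bigr => i _.
rewrite /dot mulr_suml mulr_sumr; apply: eq_bigr => k _.
by rewrite !mulr_sumr; apply: eq_bigr => l _; ring.
Qed.

Let trace_sum (c : I -> R) (Q : 'M[R]_d) :
  (forall k l : 'I_d, (k <= l)%N -> \sum_i c i * (w i k 0 * w i l 0) = Q k l) ->
  (d%:R + 2) * \sum_i c i = \tr Q.
Proof.
move=> cQ; rewrite mulr_sumr /mxtrace.
under [RHS]eq_bigr => k _ do rewrite -cQ //.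
rewrite exchange_big; apply: eq_bigr => i _.
by rewrite -mulr_sumr -(dotww i) mulrC.
Qed.

(** In a linear relation between the squares with coefficients [c], the trace gives
    [\sum_i c i = 0], and evaluation at [w j] then leaves [a * c j = 0]. Being independent, the
    squares span by dimension. *)
Let sq_full : row_full sq.
Proof.
have cP : #|{: P}| = #|I|.
  apply/eqP; rewrite -(eqn_pmul2r (isT : 0 < 2)%N) cardI.
  by rewrite card_sig card_pairs_leq.
suff /eqP rk : row_free sq by rewrite /row_full rk cP.
apply: inj_row_free => u usq.
pose c i := u 0 (enum_rank i).
have cQ (k l : 'I_d) : (k <= l)%N -> \sum_i c i * (w i k 0 * w i l 0) = (0 :
  'M[R]_d) k l.
  move=> kl; have /matrixP/(_ 0 (enum_rank (exist _ (k, l) kl : P))) := usq.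
  rewrite [RHS]mxE !mxE; apply: etrans.
  rewrite (reindex (@enum_val I xpredT)) /=; last exact/onW_bij/enum_val_bij.
  by apply: eq_bigr => i _; rewrite !mxE /c enum_valK enum_rankK.
have c0 j : c j = 0.
  have := dot_sum_sq c j; rewrite (trace_sum cQ) mxtrace0 addr0.
  under eq_bigr => i _ do rewrite expr2.
  rewrite (dot_prod_sum cQ (trmx0 _ _ _)) big1 => [/esym/eqP|k _]; last first.
    by rewrite big1 // => l _; rewrite mxE mul0r.
  by rewrite mulf_eq0 (negbTE a_neq0) => /eqP.
by apply/matrixP => i j; rewrite !ord1 -(enum_valK j) [LHS]c0 mxE.
Qed.

Let sq_span (Q : 'M[R]_d) : exists c : I -> R,
  forall k l : 'I_d, (k <= l)%N -> \sum_i c i * (w i k 0 * w i l 0) = Q k l.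
Proof.
pose q : 'rV[R]_#|{: P}| := \row_l Q (val (enum_val l)).1 (val (enum_val l)).2.
have /submxP [u qE] : (q <= sq)%MS by apply: submx_full sq_full.
exists (fun i => u 0 (enum_rank i)) => k l kl.
have /matrixP/(_ 0 (enum_rank (exist _ (k, l) kl : P))) := qE.
rewrite !mxE enum_rankK /= => ->.
rewrite (reindex (@enum_val I xpredT)) /=; last exact/onW_bij/enum_val_bij.
by apply: eq_bigr => i _; rewrite !mxE enum_valK enum_rankK.
Qed.

(** Here [c] expands the symmetrised product of [x] and [y] in the squares. The conclusions evaluate
    this expansion at [w i], take its trace, and evaluate it at [z] and [t]. *)
Let dot_sq_span x y : exists c : I -> R,
  [/\ forall i, dot (w i) x * dot (w i) y = a * c i + dot x y,
      (d%:R + 2) * \sum_i c i = dot x y &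
      forall z t, \sum_i c i * (dot (w i) z * dot (w i) t) =
        2^-1 * (dot x z * dot y t + dot x t * dot y z)].
Proof.
pose Q := 2^-1 *: (x *m y^T + y *m x^T).
have Qs : Q^T = Q by rewrite linearZ linearD /= !trmx_mul !trmxK addrC.
have QE k l : Q k l = 2^-1 * (x k 0 * y l 0 + y k 0 * x l 0).
  by rewrite !mxE !big_ord1 !mxE.
have Qzt z t : \sum_k \sum_l Q k l * (z k 0 * t l 0) =
    2^-1 * (dot x z * dot y t + dot x t * dot y z).
  rewrite [dot x t * _]mulrC /dot !mulr_suml -big_split mulr_sumr.
  apply: eq_bigr => k _; rewrite !mulr_sumr -big_split mulr_sumr.
  by apply: eq_bigr => l _; rewrite QE /=; ring.
have trQ : \tr Q = dot x y.
  by apply: eq_bigr => k _; rewrite QE; field.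
have [c cQ] := sq_span Q.
have sc := trace_sum cQ; rewrite trQ in sc.
exists c; split=> // [j|z t]; last by rewrite (dot_prod_sum cQ Qs) Qzt.
have := dot_sum_sq c j; rewrite sc => <-.
under eq_bigr => i _ do rewrite expr2.
by rewrite (dot_prod_sum cQ Qs) Qzt !(dotC (w j)); field.
Qed.

Lemma equiangular_design2 x y :
  \sum_i dot (w i) x * dot (w i) y = a / 2 * dot x y.
Proof.
have [c [cE sc _]] := dot_sq_span x y.
under eq_bigr => i _ do rewrite cE.
rewrite big_split /= -mulr_sumr sumr_const -[dot x y *+ _]mulr_natr.
have -> : #|I|%:R = d%:R * (d%:R + 1) / 2 :> R.
  by rewrite natr1 -natrM -cardI natrM mulfK ?pnatr_eq0.
by rewrite -sc /a; field.
Qed.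

Lemma equiangular_design4 x y z t :
  \sum_i dot (w i) x * dot (w i) y * (dot (w i) z * dot (w i) t) =
  a / 2 * (dot x y * dot z t + dot x z * dot y t + dot x t * dot y z).
Proof.
have [c [cE _ c4]] := dot_sq_span x y.
under eq_bigr => i _ do rewrite cE mulrDl -mulrA.
by rewrite big_split /= -!mulr_sumr c4 equiangular_design2; field.
Qed.

End EquiangularDesign.

(** * Cubic forms on an integral design *)

Section Scalar.
Variable R : realType.
Implicit Types (a b t s x : R).

Lemma normM_le a b (A B : R) : `|a| <= A -> `|b| <= B -> `|a * b| <= A * B.
Proof. by move=> aA bB; rewrite normrM ler_pM. Qed.

Lemma normD_le a b (A B : R) : `|a| <= A -> `|b| <= B -> `|a + b| <= A + B.
Proof. by move=> aA bB; apply: le_trans (ler_normD _ _) _; rewrite lerD. Qed.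

Lemma norm_sqr_le a (A : R) : 0 <= A -> a ^+ 2 <= A ^+ 2 -> `|a| <= A.
Proof.
move=> A0; rewrite -ler_sqrt ?sqr_ge0 // !sqrtr_sqr (ger0_norm A0) //.
Qed.

Lemma norm_factor_le k y (m c : R) : 0 < m -> m <= `|k| -> `|k * y| <= c ->
  `|y| <= c / m.
Proof.
move=> m0 mk; rewrite normrM => h; rewrite ler_pdivlMr //.
by apply: le_trans h; rewrite mulrC ler_wpM2r.
Qed.

Lemma near_roots_pm1 t (c : R) : `|t ^+ 3 - t| <= c ->
  exists2 u, u \in [:: 0; 1; -1] & `|t - u| <= c / (1 / 2).
Proof.
move=> H; have [t1|t1] := leP t (-1 / 2).
  exists (-1); rewrite ?inE ?eqxx ?orbT //.
  apply: (@norm_factor_le (t * (t - 1))) => //.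
    by rewrite ler_normr; apply/orP; left; nra.
  by move: H; congr (`|_| <= _); ring.
have [t2|t2] := leP t (1 / 2).
  exists 0; rewrite ?inE ?eqxx //.
  apply: (@norm_factor_le (t ^+ 2 - 1)) => //.
    by rewrite ler_normr; apply/orP; right; nra.
  by move: H; congr (`|_| <= _); ring.
exists 1; rewrite ?inE ?eqxx ?orbT //.
apply: (@norm_factor_le (t * (t + 1))) => //.
  by rewrite ler_normr; apply/orP; left; nra.
by move: H; congr (`|_| <= _); ring.
Qed.

Lemma near_roots_pm2 s (c : R) : `|s ^+ 3 - 4 * s| <= c ->
  exists2 u, u \in [:: 0; 2; -2] & `|s - u| <= c / 3.
Proof.
move=> H; have [t1|t1] := leP s (-1).
  exists (-2); rewrite ?inE ?eqxx ?orbT //.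
  apply: (@norm_factor_le (s * (s - 2))) => //.
    by rewrite ler_normr; apply/orP; left; nra.
  by move: H; congr (`|_| <= _); ring.
have [t2|t2] := leP s 1.
  exists 0; rewrite ?inE ?eqxx //.
  apply: (@norm_factor_le (s ^+ 2 - 4)) => //.
    by rewrite ler_normr; apply/orP; right; nra.
  by move: H; congr (`|_| <= _); ring.
exists 2; rewrite ?inE ?eqxx ?orbT //.
apply: (@norm_factor_le (s * (s + 2))) => //.
  by rewrite ler_normr; apply/orP; left; nra.
by move: H; congr (`|_| <= _); ring.
Qed.

Lemma int_eq a b : a \is a Num.int -> b \is a Num.int -> `|a - b| < 1 -> a = b .
Proof.
move=> aZ bZ; rewrite ltNge => ab; apply/eqP; rewrite -subr_eq0.
by apply: contraNT ab => ab; rewrite norm_intr_ge1 ?rpredB.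
Qed.

End Scalar.

(* [3 * m] is the total mass N'; the bounds 100 and 25 are attained for d = 23. *)
Record integral_design (R : realType) (d m : nat) (I : finType)
    (w : I -> 'cV[R]_d) : Prop := IntegralDesign {
  design_gt0 : (0 < m)%N;
  design_le : (m <= 100)%N;
  design_card : (#|I| <= 3 * m)%N;
  design_norm : forall i, dot (w i) (w i) <= 25;
  design_int : forall i j, dot (w i) (w j) \is a Num.int;
  design2 : forall x y,
    \sum_i dot (w i) x * dot (w i) y = 3 * m%:R * dot x y;
  design4 : forall x y z t,
    \sum_i dot (w i) x * dot (w i) y * (dot (w i) z * dot (w i) t) =
    3 * m%:R * (dot x y * dot z t + dot x z * dot y t + dot x t * dot y z) }.

Lemma design_scale (R : realType) (d m : nat) (I : finType) (w : I -> 'cV[R]_d) :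
  integral_design m w -> 1 <= (m%:R : R) <= 100.
Proof. by case=> m0 m1 _ _ _ _ _; rewrite ler1n m0 ler_nat. Qed.

Lemma norm_sum_le (R : realType) (d m : nat) (I : finType) (w : I -> 'cV[R]_d)
    (F : I -> R) B : integral_design m w -> (forall i, `|F i| <= B) -> 0 <= B ->
  `|\sum_i F i| <= 3 * m%:R * B.
Proof.
move=> D FB B0; apply: le_trans (ler_norm_sum _ _ _) _.
apply: le_trans (ler_sum _ (fun i _ => FB i)) _.
rewrite sumr_const -[B *+ _]mulr_natl ler_wpM2r //.
by rewrite -natrM ler_nat (design_card D).
Qed.

Lemma dot_le (R : realType) (d m : nat) (I : finType) (w : I -> 'cV[R]_d) i x b :
  integral_design m w -> dot x x <= b ^+ 2 -> 0 <= b -> `|dot (w i) x| <= 5 * b.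
Proof.
move=> D xb b0; apply: norm_sqr_le; first by rewrite mulr_ge0.
apply: le_trans (dot_CauchySchwarz _ _) _.
have -> : (5 * b) ^+ 2 = 25 * b ^+ 2 by ring.
by rewrite ler_pM ?dotxx_ge0 ?(design_norm D).
Qed.

(* The residual of the orthogonal projection of an integer vector onto the
   linear functionals has its entries in [(3 m)^-1 Z]. *)
Lemma near_linear (R : realType) (d m : nat) (I : finType) (w : I -> 'cV[R]_d)
    (u : I -> R) z t : integral_design m w ->
  (forall i, u i \is a Num.int) -> (forall i, `|dot (w i) z - u i| <= t) ->
  0 <= t -> 8000 * t < 1 ->
  exists z0, (forall i, dot (w i) z0 = u i) /\ dot (z - z0) (z - z0) <= t ^+ 2.
Proof.
move=> D uZ zu t0 t_small; have /andP[N1 N100] := design_scale D.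
have N3 : 0 < 3 * m%:R :> R by rewrite mulr_gt0 // (lt_le_trans ltr01).
have N0 := lt0r_neq0 N3.
(* By [design2] this is the orthogonal projection of [u], a function on the lines, onto the linear
   functionals. *)
pose z0 := (3 * m%:R)^-1 *: \sum_j u j *: w j.
have z0E i : 3 * m%:R * dot (w i) z0 = \sum_j dot (w j) (w i) * u j.
  rewrite dotC dotZl mulrA divff // mul1r dot_suml.
  by apply: eq_bigr => j _; rewrite dotZl mulrC.
have wz0 i : dot (w i) z0 = u i.
  (* After multiplication by [3 * m] both sides are integers, and they differ by at most
     [7500 * t + 300 * t < 1]. *)
  apply: (mulfI N0); apply: int_eq.
  - by rewrite z0E rpred_sum // => j _; rewrite rpredM // (design_int D).
  - by rewrite !rpredM ?natr_int.
  have -> : 3 * m%:R * dot (w i) z0 - 3 * m%:R * u i =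
      \sum_j dot (w j) (w i) * - (dot (w j) z - u j) +
        3 * m%:R * (dot (w i) z - u i).
    have -> : \sum_j dot (w j) (w i) * - (dot (w j) z - u j) =
        3 * m%:R * dot (w i) z0 - 3 * m%:R * dot (w i) z.
      by rewrite z0E -(design2 D) -sumrB; apply: eq_bigr => j _; ring.
    by ring.
  have t25 : 0 <= 25 * t by rewrite mulr_ge0.
  have h1 j : `|dot (w j) (w i) * - (dot (w j) z - u j)| <= 25 * t.
    apply: normM_le; last by rewrite normrN.
    have e25 : 25 = 5 * 5 :> R by ring.
    by rewrite e25; apply: (dot_le _ D) => //; rewrite expr2 -e25 (design_norm D).
  have h2 : `|3 * m%:R * (dot (w i) z - u i)| <= 300 * t.
    apply: normM_le (zu i); rewrite gtr0_norm //.
    by move: N100; clear; lra.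
  apply: le_lt_trans (normD_le (norm_sum_le D h1 t25) h2) _.
  have Nt : m%:R * t <= 100 * t by rewrite ler_wpM2r.
  by move: Nt t_small; clear; lra.
exists z0; split=> //.
rewrite -(ler_pM2l N3) -(design2 D); apply: le_trans (ler_norm _) _.
apply: (norm_sum_le D) => [i|]; last exact: sqr_ge0.
by have := zu i; rewrite dotBr wz0 expr2 => h; exact: normM_le.
Qed.

(** * Estimates at a single line of the design *)

Section ScalarEstimates.
Variable R : realType.
Implicit Types (dl mu ep t u T S X : R).

(* [level1] is [f] minus its projection onto the linear functionals, and [level3]
   is the part of it of order [dl * mu]. *)
Definition level3 ep S X : R := S ^+ 3 - 3 * S + ep * ((S ^+ 2 - 1) * X).

Definition level1 dl mu ep T S X : R :=
  T ^+ 3 - T + dl * (T * (S ^+ 2 - 1) + mu * level3 ep S X).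

Lemma sqr_sub1_le S : `|S| <= 5 -> `|S ^+ 2 - 1| <= 24.
Proof. by rewrite !ler_norml => /andP[h1 h2]; apply/andP; clear - h1 h2; split;
  nra. Qed.

Lemma level3_le ep S X : 0 < ep -> ep <= 1 / 100 -> `|S| <= 5 -> `|X| <= 5 ->
  `|level3 ep S X| <= 112.
Proof.
move=> ep0 ep_le S5 X5; have S3 : `|S ^+ 3 - 3 * S| <= 5 * 22.
  rewrite (_ : _ - _ = S * (S ^+ 2 - 3)); last by ring.
  apply: normM_le => //; move: S5; rewrite !ler_norml => /andP[h1 h2].
  by apply/andP; clear - h1 h2; split; nra.
have := normM_le (sqr_sub1_le S5) X5.
have ep1 : `|ep| <= 1 / 100 by rewrite gtr0_norm.
move/(normM_le ep1)/(normD_le S3)/le_trans; apply; clear; lra.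
Qed.

Lemma level1_zero dl mu ep T S X :
  0 < dl -> 0 < mu -> mu <= 1 / 10 -> 0 < ep -> ep <= 1 / 100 ->
  `|T| <= 3 -> `|S| <= 5 -> `|X| <= 5 ->
  level1 dl mu ep T S X = 0 -> `|T ^+ 3 - T| <= 100 * dl.
Proof.
move=> dl0 mu0 mu_le ep0 ep_le T3 S5 X5 /eqP; rewrite addr_eq0 => /eqP ->;
  rewrite normrN mulrC.
apply: normM_le; last by rewrite gtr0_norm.
have mu1 : `|mu| <= 1 / 10 by rewrite gtr0_norm.
apply: le_trans (normD_le (normM_le T3 (sqr_sub1_le S5)) (normM_le mu1 (level3_le
  ep0 ep_le S5 X5))) _.
by clear; lra.
Qed.

(** For [u = 1] or [u = -1], the equation is expanded about [T = u] and multiplied by [S ^ 2 - 1];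
    the square survives because [u * T >= 1 / 2]. The term linear in [T - u] is kept exact, to be
    summed over the design. *)
Lemma level1_weighted dl mu ep t u T S X :
  0 < dl -> 0 < mu -> 0 < ep -> ep <= 1 / 100 ->
  u \in [:: 0; 1; -1] -> `|S| <= 5 -> `|X| <= 5 ->
  `|T - u| <= t -> t <= 1 / 2 -> level1 dl mu ep T S X = 0 ->
  dl / 2 * (u * (S ^+ 2 - 1)) ^+ 2 <=
    - 2 * (u * (S ^+ 2 - 1) * (T - u)) + (96 * t ^+ 2 + 2700 * (dl * mu)).
Proof.
move=> dl0 mu0 ep0 ep_le uE S5 X5 Tu t2; rewrite /level1;
  have := level3_le ep0 ep_le S5 X5.
have := sqr_sub1_le S5; move: (S ^+ 2 - 1) (level3 ep S X) => H k H24 k112.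
have t0 : 0 <= t by apply: le_trans Tu.
have dm0 : 0 < dl * mu by rewrite mulr_gt0.
have tsq : (T - u) ^+ 2 <= t ^+ 2.
  by rewrite -[(T - u) ^+ 2]real_normK ?num_real // ler_pXn2r ?nnegrE.
have b1 : `|H * ((T - u) ^+ 2 * (3 * u + (T - u)))| <= 24 * (t ^+ 2 * 4).
  apply: normM_le => //; apply: normM_le; first by rewrite ger0_norm ?sqr_ge0.
  move: uE Tu; clear - t2; rewrite !inE !ler_norml => /or3P[] /eqP -> /andP[h1 h2];
  by apply/andP; split; lra.
have b2 : `|dl * mu * (H * k)| <= dl * mu * (24 * 112).
  by apply: normM_le; [rewrite gtr0_norm | apply: normM_le].
move: uE Tu b1 b2; rewrite !ler_norml !inE.
case/or3P => /eqP -> /andP[h1 h2] /andP[b1 b1'] /andP[b2 b2'] E0.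
- by move: dm0 (sqr_ge0 t); clear; lra.
- have H2 : dl * H ^+ 2 * (T - 1 / 2) >= 0.
    apply: mulr_ge0; first by rewrite mulr_ge0 ?sqr_ge0 // ltW.
    by move: h1 t2; clear; lra.
  have E1 : H * (T ^+ 3 - T + dl * (T * H + mu * k)) = 0 by rewrite E0 mulr0.
  by move: b1 b1' b2 b2' dm0 H2 E1 (sqr_ge0 t); clear; lra.
- have H2 : dl * H ^+ 2 * (- T - 1 / 2) >= 0.
    apply: mulr_ge0; first by rewrite mulr_ge0 ?sqr_ge0 // ltW.
    by move: h2 t2; clear; lra.
  have E1 : H * (T ^+ 3 - T + dl * (T * H + mu * k)) = 0 by rewrite E0 mulr0.
  by move: b1 b1' b2 b2' dm0 H2 E1 (sqr_ge0 t); clear; lra.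
Qed.

(** Near [T = 0] the leading term is essentially [- T]; [T ^ 3] and [dl * T * (S ^ 2 - 1)] are of
    higher order when [t] is of order [dl]. *)
Lemma level1_off dl mu ep t T S X : 0 < dl -> `|S| <= 5 -> `|T| <= t ->
  level1 dl mu ep T S X = 0 ->
  `|dl * mu * level3 ep S X - T| <= t ^+ 2 * t + dl * (t * 24).
Proof.
move=> dl0 S5 Tt; have t0 : 0 <= t by apply: le_trans Tt.
have tsq : `|T ^+ 2| <= t ^+ 2 by rewrite normrX ler_pXn2r ?nnegrE.
have dl1 : `|- dl| <= dl by rewrite normrN gtr0_norm.
have Tt' : `|- T| <= t by rewrite normrN.
have := normD_le (normM_le tsq Tt') (normM_le dl1 (normM_le Tt (sqr_sub1_le S5))).
rewrite /level1; move: (level3 ep S X) => k h E0.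
suff -> : dl * mu * k - T = T ^+ 2 * - T + - dl * (T * (S ^+ 2 - 1)) by [].
by move: E0; clear; lra.
Qed.

Lemma near_pm1 S eta : (S ^+ 2 - 1) ^+ 2 <= eta ^+ 2 -> 0 <= eta ->
  `|S - (if 0 <= S then 1 else -1)| <= eta.
Proof.
move=> h eta0; have := norm_sqr_le eta0 h.
have [S0|S0] := leP 0 S => h'.
  rewrite -[eta]divr1; apply: (@norm_factor_le _ (S + 1)) => //.
    by rewrite ler_normr; apply/orP; left; lra.
  by move: h'; congr (`|_| <= _); ring.
rewrite -[eta]divr1; apply: (@norm_factor_le _ (S - 1)) => //.
  by rewrite ler_normr; apply/orP; right; lra.
by move: h'; congr (`|_| <= _); ring.
Qed.

(* [S] is close to a root of [s ^ 3 = 4 s], hence, being close to [N^-1 Z],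
   much closer to it; then the other factor has to vanish. *)
Lemma level3_off ep (N k eta th S X : R) :
  0 < ep -> 1 <= N -> N \is a Num.int -> N <= 100 -> k \is a Num.int ->
  `|N * S - k| <= 7500 * eta -> 0 <= eta -> `|S| <= 5 -> `|X| <= 5 ->
  `|level3 ep S X - S| <= th ->
  5000 * ep <= 1 -> 1000 * th <= 1 -> 1000 * 1000 * eta <= 1 ->
  20 * (th + 400 * 1000 * eta) <= ep -> `|X| <= 1 / 10.
Proof.
move=> ep0 N1 NZ N100 kZ Sk eta0 S5 X5 kap ep5 th1 eta1 final.
pose D := ep * ((S ^+ 2 - 1) * X).
have kapE : level3 ep S X - S = S ^+ 3 - 4 * S + D by rewrite /level3 /D; ring.
have D_le : `|D| <= ep * (24 * 5).
  apply: normM_le; first by rewrite gtr0_norm.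
  by apply: normM_le => //; exact: sqr_sub1_le.
have : `|S ^+ 3 - 4 * S| <= th + ep * (24 * 5).
  rewrite (_ : _ - _ = (level3 ep S X - S) + - D); last by rewrite kapE; ring.
  by apply: normD_le => //; rewrite normrN.
case/near_roots_pm2 => s sE Ss.
have sZ : s \is a Num.int.
  by move: sE; rewrite !inE => /or3P[] /eqP ->; rewrite ?rpredN ?natr_int.
(* Two integers at distance below 1. This trades the coarse bound on [S - s], of order [th + ep],
   for one of order [eta]. *)
have kE : k = N * s.
  apply: int_eq => //; first by rewrite rpredM.
  have -> : k - N * s = - (N * S - k) + N * (S - s) by ring.
  have NN : `|N| <= 100 by rewrite ger0_norm //; move: N1; clear; lra.
  have Sk' : `|- (N * S - k)| <= 7500 * eta by rewrite normrN.
  apply: le_lt_trans (normD_le Sk' (normM_le NN Ss)) _.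
  by move: eta1 ep5 th1; clear; lra.
have {}Ss : `|S - s| <= 7500 * eta.
  rewrite -[X in _ <= X]divr1; apply: (@norm_factor_le _ N) => //.
    by rewrite ger0_norm //; move: N1; clear; lra.
  by rewrite mulrBr -kE.
have {}D_le : `|D| <= th + 400 * 1000 * eta.
  rewrite (_ : D = (level3 ep S X - S) + - (S ^+ 3 - 4 * S));
    last by rewrite kapE; ring.
  apply: normD_le => //; rewrite normrN.
  have e0 : 7500 * eta * (7 * 7) <= 400 * 1000 * eta by move: eta0; clear; lra.
  apply: le_trans e0.
  have h2 : `|S - 2| <= 7 by move: S5; rewrite !ler_norml; clear => /andP[? ?];
    apply/andP; split; lra.
  have h2' : `|S + 2| <= 7 by move: S5; rewrite !ler_norml; clear => /andP[? ?];
    apply/andP; split; lra.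
  have h0 : `|S| <= 7 by move: S5; clear; lra.
  move: sE Ss; rewrite !inE => /or3P[] /eqP ->.
  - rewrite subr0 => Ss.
    have := normM_le Ss (normM_le h2 h2'); congr (`|_| <= _); ring.
  - move=> Ss; have := normM_le Ss (normM_le h0 h2'); congr (`|_| <= _); ring.
  - rewrite opprK => Ss; have := normM_le Ss (normM_le h0 h2); congr (`|_| <= _);
    ring.
have H2 : 1 / 2 <= `|S ^+ 2 - 1|.
  have e1 : 7500 * eta <= 1 / 10 by move: eta1; clear; lra.
  move: sE (le_trans Ss e1); rewrite !inE ler_norml ler_normr; clear.
  by case/or3P => /eqP -> /andP[h1 h2]; apply/orP; [right|left|left]; nra.
have D2 : `|(ep * (S ^+ 2 - 1)) * X| <= th + 400 * 1000 * eta by rewrite -mulrA.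
have e2 : 0 < ep / 2 by rewrite divr_gt0.
have e3 : ep / 2 <= `|ep * (S ^+ 2 - 1)|.
  by rewrite normrM gtr0_norm // ler_pM2l //; move: H2; clear; lra.
apply: le_trans (norm_factor_le e2 e3 D2) _.
by rewrite ler_pdivrMr //; move: final; clear; lra.
Qed.

End ScalarEstimates.

(** * Rigidity: what the equations impose on the whole design *)

Lemma dot_unit_le (R : realType) d (x y : 'cV[R]_d) t :
  dot x x <= t ^+ 2 -> dot y y <= 1 -> 0 <= t -> `|dot x y| <= t.
Proof.
move=> xt y1 t0; apply: norm_sqr_le => //.
apply: le_trans (dot_CauchySchwarz _ _) _.
by rewrite -[t ^+ 2]mulr1 ler_pM ?dotxx_ge0.
Qed.

(** Rounding to the roots of [t ^ 3 = t] gives an integer vector, which [near_linear] makes linear.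
    The norm of [p0] is exact because [3 * m * dot p0 p0] is a sum of integers close to the integer
    [m]. *)
Lemma exists_axis (R : realType) d m (I : finType) (w : I -> 'cV[R]_d)
    (dl : R) (p : 'cV[R]_d) :
  integral_design m w -> 0 < dl -> 10 * 1000 * 1000 * dl <= 1 -> dot p p = 1 / 3 ->
  (forall i, `|dot (w i) p ^+ 3 - dot (w i) p| <= 100 * dl) ->
  exists p0, [/\ forall i, dot (w i) p0 \in [:: 0; 1; -1],
    forall i, `|dot (w i) p - dot (w i) p0| <= 200 * dl,
    dot (p - p0) (p - p0) <= (200 * dl) ^+ 2 & dot p0 p0 = 1 / 3].
Proof.
move=> D dl0 dl_small pp Tu.
have /fin_all_exists2 [u uE u_near] i := near_roots_pm1 (Tu i).
have uZ i : u i \is a Num.int.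
  by move: (uE i); rewrite !inE => /or3P[] /eqP ->; rewrite ?rpredN ?rpred0 ?rpred1.
have {}u_near i : `|dot (w i) p - u i| <= 200 * dl.
  by apply: le_trans (u_near i) _; clear; lra.
have t0 : 0 <= 200 * dl by move: dl0; clear; lra.
have t_small : 8000 * (200 * dl) < 1 by move: dl_small dl0; clear; lra.
have [p0 [p0E pp0]] := near_linear D uZ u_near t0 t_small.
exists p0; split=> // [i|i|]; rewrite ?p0E //.
have /andP[N1 N100] := design_scale D.
have N3 : 0 < 3 * m%:R :> R by rewrite mulr_gt0 // (lt_le_trans ltr01).
apply: (mulfI (lt0r_neq0 N3)); apply: int_eq.
- rewrite -(design2 D) rpred_sum // => i _; by rewrite p0E rpredM.
- by rewrite (_ : _ * _ = m%:R) ?natr_int //; field.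
have pe : `|dot (p - p0) p| <= 200 * dl.
  apply: dot_unit_le => //. by rewrite pp; clear; lra.
have -> : 3 * m%:R * dot p0 p0 - 3 * m%:R * (1 / 3) =
    3 * m%:R * (dot (p - p0) (p - p0) + (- 2) * dot (p - p0) p).
  by rewrite !(dotBl, dotBr) pp (dotC p0 p); field.
have e1 : `|3 * m%:R : R| <= 300 by rewrite gtr0_norm //; move: N100; clear; lra.
have e2 : `|dot (p - p0) (p - p0)| <= 200 * dl.
  rewrite ger0_norm ?dotxx_ge0 //; apply: le_trans pp0 _.
  by move: dl0 dl_small; clear; nra.
have e3 : `|-2 : R| <= 2 by rewrite normrN ger0_norm.
apply: le_lt_trans (normM_le e1 (normD_le e2 (normM_le e3 pe))) _.
by move: dl0 dl_small; clear; lra.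
Qed.

(** Sum [level1_weighted] over the design. The moments turn the first-order terms into
    [6 * m * <p - p0, q> ^ 2] up to sign, of order [dl ^ 2]; after division by [dl], what remains is
    of order [dl + mu], hence below [eta ^ 2]. *)
Lemma on_axis (R : realType) d m (I : finType) (w : I -> 'cV[R]_d)
    (dl mu ep eta : R) (p p0 q r : 'cV[R]_d) :
  integral_design m w ->
  0 < dl -> 0 < mu -> 0 < ep -> ep <= 1 / 100 -> 0 < eta -> eta <= 1 ->
  4 * 1000 * 1000 * mu <= eta ^+ 2 -> 10 * 1000 * 1000 * 1000 * dl <= mu * eta ->
  dot q q = 1 -> dot p q = 0 -> dot r r = 1 ->
  (forall i, dot (w i) p0 \in [:: 0; 1; -1]) ->
  (forall i, `|dot (w i) p - dot (w i) p0| <= 200 * dl) ->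
  dot (p - p0) (p - p0) <= (200 * dl) ^+ 2 -> dot p0 p0 = 1 / 3 ->
  (forall i, level1 dl mu ep (dot (w i) p) (dot (w i) q) (dot (w i) r) = 0) ->
  forall i, (dot (w i) p0 * (dot (w i) q ^+ 2 - 1)) ^+ 2 <= eta ^+ 2.
Proof.
move=> D dl0 mu0 ep0 ep_le eta0 eta1 mu_eta dl_mu qq pq rr p0E pp0 e_le p0p0 E i.
have /andP[N1 N100] := design_scale D.
pose h j := dot (w j) p0 * (dot (w j) q ^+ 2 - 1).
apply: (@le_trans _ _ (\sum_j h j ^+ 2)).
  by rewrite (bigD1 i) //= lerDl sumr_ge0 // => j _; exact: sqr_ge0.
have w5 x j : dot x x = 1 -> `|dot (w j) x| <= 5.
  move=> xx; rewrite -[5]mulr1; apply: (dot_le _ D) => //.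
  by rewrite xx expr1n.
have mu1 : mu <= 1 by move: mu_eta eta1 eta0 mu0; clear; nra.
have dl_small : 10 * 1000 * 1000 * 1000 * dl <= mu.
  by apply: le_trans dl_mu _; rewrite ler_piMr // ltW.
have t2 : 200 * dl <= 1 / 2 by move: dl_small mu1 dl0; clear; lra.
pose B := 96 * (200 * dl) ^+ 2 + 2700 * (dl * mu).
have B0 : 0 <= B.
  rewrite /B; move: (mulr_gt0 dl0 mu0) (sqr_ge0 (200 * dl)).
  by clear; lra.
have step j : dl / 2 * h j ^+ 2 <=
    - 2 * (h j * (dot (w j) p - dot (w j) p0)) + B.
  by apply: (level1_weighted dl0 mu0 ep0 ep_le _ _ _ _ t2 (E j)); rewrite ?w5.
have : dl / 2 * \sum_j h j ^+ 2 <=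
    - 2 * (\sum_j h j * (dot (w j) p - dot (w j) p0)) + 3 * m%:R * B.
  rewrite !mulr_sumr; apply: le_trans (ler_sum _ (fun j _ => step j)) _.
  rewrite big_split lerD2l sumr_const -[B *+ _]mulr_natl; apply: (ler_wpM2r B0).
  by rewrite -natrM ler_nat (design_card D).
have -> : \sum_j h j * (dot (w j) p - dot (w j) p0) =
    - (6 * m%:R * dot (p - p0) q ^+ 2).
  transitivity (\sum_j dot (w j) p0 * dot (w j) p * (dot (w j) q * dot (w j) q) -
    \sum_j dot (w j) p0 * dot (w j) p -
    \sum_j dot (w j) p0 * dot (w j) p0 * (dot (w j) q * dot (w j) q) +
    \sum_j dot (w j) p0 * dot (w j) p0).
    by rewrite -!sumrB -big_split; apply: eq_bigr => j _; rewrite /h /=; ring.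
  by rewrite !(design4 D) !(design2 D) qq p0p0 pq dotBl pq; field.
have eq2 : dot (p - p0) q ^+ 2 <= (200 * dl) ^+ 2.
  by apply: le_trans (dot_CauchySchwarz _ _) _; rewrite qq mulr1.
move: eq2 mu_eta dl_small mu0 dl0 N1 N100; rewrite /B.
move: (dot (p - p0) q ^+ 2) (\sum_j h j ^+ 2) (m%:R : R) => a s N;
  clear=> ha hmu hdl mu0 dl0 N1 N100 hs.
have dm0 := mulr_gt0 dl0 mu0; have t0 := sqr_ge0 (200 * dl).
have Na : N * a <= 100 * (200 * dl) ^+ 2.
  by move: N1 N100 ha t0; move: ((200 * dl) ^+ 2) => b; clear; nra.
have NB : N * (96 * (200 * dl) ^+ 2 + 2700 * (dl * mu)) <=
    100 * (96 * (200 * dl) ^+ 2 + 2700 * (dl * mu)).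
  apply: (ler_wpM2r _ N100); by move: dm0 t0; clear; lra.
have {}hs : dl * s <= dl * (2400 * 1000 * 1000 * dl + 1620 * 1000 * mu).
  by move: hs Na NB; lra.
move: hs; rewrite ler_pM2l //; move: hmu hdl mu0 dl0; clear; lra.
Qed.

Lemma pm1_sqr (R : realType) (u : R) : u \in [:: 0; 1; -1] -> u = 0 \/ u ^+ 2 = 1.
Proof. by rewrite !inE => /or3P[] /eqP ->; [left | right; ring | right; ring]. Qed.

Lemma pm1_le (R : realType) (u : R) : u \in [:: 0; 1; -1] -> `|u| <= 1.
Proof. by rewrite !inE => /or3P[] /eqP ->; rewrite ?normr0 ?normrN ?normr1. Qed.

Lemma pm1_int (R : realType) (u : R) : u \in [:: 0; 1; -1] -> u \is a Num.int.
Proof. by rewrite !inE => /or3P[] /eqP ->; rewrite ?rpredN ?rpred0 ?rpred1. Qed.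

(** As [w i] is orthogonal to [p0], the fourth moment recovers [m * dot (w i) q] from the values of
    [q] where [p0] does not vanish. These are within [eta] of signs, and the signs produce the
    integer. *)
Lemma off_axis_int (R : realType) d m (I : finType) (w : I -> 'cV[R]_d)
    (eta : R) (p0 q : 'cV[R]_d) :
  integral_design m w -> 0 <= eta -> dot p0 p0 = 1 / 3 ->
  (forall i, dot (w i) p0 \in [:: 0; 1; -1]) ->
  (forall i, (dot (w i) p0 * (dot (w i) q ^+ 2 - 1)) ^+ 2 <= eta ^+ 2) ->
  forall i, dot (w i) p0 = 0 ->
  exists2 k, k \is a Num.int & `|m%:R * dot (w i) q - k| <= 7500 * eta.
Proof.
move=> D eta0 p0p0 p0E on i wi0; have /andP[N1 N100] := design_scale D.
pose s j : R := if 0 <= dot (w j) q then 1 else -1.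
have sZ j : s j \is a Num.int by rewrite /s; case: ifP; rewrite ?rpredN rpred1.
exists (\sum_j dot (w j) p0 * dot (w j) p0 * (dot (w j) (w i) * s j)).
  by apply: rpred_sum => j _; rewrite !rpredM ?(design_int D) // pm1_int.
have -> : m%:R * dot (w i) q =
    \sum_j dot (w j) p0 * dot (w j) p0 * (dot (w j) (w i) * dot (w j) q).
  by rewrite (design4 D) p0p0 (dotC p0 (w i)) wi0; field.
rewrite -sumrB; apply: le_trans (norm_sum_le D (B := 25 * eta) _ _) _.
- move=> j; rewrite -mulrBr -mulrBr.
  have := p0E j; case/pm1_sqr => [->|u2].
    by rewrite !mul0r normr0 mulr_ge0.
  rewrite -expr2 u2 mul1r; apply: normM_le.
    have e25 : 25 = 5 * 5 :> R by ring.
    by rewrite e25; apply: (dot_le _ D) => //; rewrite expr2 -e25 (design_norm D).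
  by apply: near_pm1 => //; have := on j; rewrite exprMn u2 mul1r.
- by rewrite mulr_ge0.
have : m%:R * eta <= 100 * eta by rewrite ler_wpM2r.
by clear; lra.
Qed.

(** On the lines orthogonal to [p0], [level1_off] puts the difference [kap] within [eta] of a linear
    functional [y]. The moments make [kap] nearly orthogonal to [y] over these lines, so [kap] is
    small. *)
Lemma off_axis_level3 (R : realType) d m (I : finType) (w : I -> 'cV[R]_d)
    (dl mu ep eta th : R) (p p0 q r : 'cV[R]_d) :
  integral_design m w ->
  0 < dl -> 0 < mu -> mu <= 1 -> 0 < ep -> ep <= 1 / 100 -> 0 < eta -> eta <= 1 ->
  10 * 1000 * 1000 * 1000 * dl <= mu * eta -> 0 <= th ->
  2 * 1000 * 1000 * eta <= th ^+ 2 ->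
  dot p p = 1 / 3 -> dot q q = 1 -> dot p q = 0 -> dot r r = 1 -> dot q r = 0 ->
  (forall i, dot (w i) p0 \in [:: 0; 1; -1]) ->
  (forall i, `|dot (w i) p - dot (w i) p0| <= 200 * dl) ->
  dot (p - p0) (p - p0) <= (200 * dl) ^+ 2 -> dot p0 p0 = 1 / 3 ->
  (forall i, level1 dl mu ep (dot (w i) p) (dot (w i) q) (dot (w i) r) = 0) ->
  (forall i, (dot (w i) p0 * (dot (w i) q ^+ 2 - 1)) ^+ 2 <= eta ^+ 2) ->
  forall i, dot (w i) p0 = 0 ->
  `|level3 ep (dot (w i) q) (dot (w i) r) - dot (w i) q| <= th.
Proof.
move=> D dl0 mu0 mu1 ep0 ep_le eta0 eta1 dl_mu th0 eta_th pp qq pq rr qr.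
move=> p0E pp0 e_le p0p0 E on i wi0.
have /andP[N1 N100] := design_scale D.
have N0 : 0 < m%:R :> R by apply: lt_le_trans N1.
have mueta : mu * eta <= 1 by rewrite mulr_ile1 // ltW.
have dm0 := mulr_gt0 dl0 mu0.
have w5 x j : dot x x = 1 -> `|dot (w j) x| <= 5.
  move=> xx; rewrite -[5]mulr1; apply: (dot_le _ D) => //.
  by rewrite xx expr1n.
pose l := (dl * mu)^-1 *: (p - p0); pose y := l - q.
pose kap j := level3 ep (dot (w j) q) (dot (w j) r) - dot (w j) q.
have kap_le j : `|kap j| <= 117.
  have e1 : `|- dot (w j) q| <= 5 by rewrite normrN w5.
  apply: le_trans (normD_le (level3_le ep0 ep_le (w5 _ j qq) (w5 _ j rr)) e1) _.
  by clear; lra.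
have kapY j : dot (w j) p0 = 0 -> `|kap j - dot (w j) y| <= eta.
  move=> wj0; have Tj : `|dot (w j) p| <= 200 * dl by have := pp0 j;
    rewrite wj0 subr0.
  have := level1_off dl0 (w5 _ j qq) Tj (E j).
  have -> : dl * mu * level3 ep (dot (w j) q) (dot (w j) r) - dot (w j) p =
      dl * mu * (kap j - dot (w j) y).
    rewrite /y dotBr dotZr dotBr wj0 subr0 /kap.
    by field; rewrite !lt0r_neq0.
  rewrite normrM gtr0_norm // => h; rewrite -(ler_pM2l dm0); apply: le_trans h _.
  have -> : (200 * dl) ^+ 2 * (200 * dl) + dl * (200 * dl * 24) =
    dl * (dl * (8 * 1000 * 1000 * dl + 4800)) by ring.
  rewrite -[dl * mu * _]mulrA ler_pM2l //; apply: le_trans (dl_mu).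
  have dl1 : dl <= 1 by move: dl_mu mueta; clear; lra.
  by move: dl0 dl1; clear; nra.
have p0q : `|dot p0 q| <= 200 * dl.
  have -> : dot p0 q = - dot (p - p0) q by rewrite dotBl pq; ring.
  rewrite normrN; apply: (dot_unit_le e_le); first by rewrite qq.
  by move: dl0; clear; lra.
have t1 : 200 * dl <= 1 / 2 by move: dl_mu mueta dl0; clear; lra.
have p0y : `|dot p0 y| <= 1.
  (* Since [p] and [p0] have equal norms, this product is of second order in [p - p0]. *)
  have ee : dot p0 (p - p0) = - (dot (p - p0) (p - p0) / 2).
    by rewrite !(dotBl, dotBr) pp p0p0 (dotC p p0); field.
  have h1 : `|dl * mu * dot p0 l| <= dl * mu * (1 / 2).
    rewrite dotZr mulVKf ?lt0r_neq0 // ee normrN ger0_norm; last first.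
      by rewrite divr_ge0 ?dotxx_ge0.
    apply: le_trans (_ : (200 * dl) ^+ 2 / 2 <= _).
      by rewrite ler_wpM2r.
    have -> : (200 * dl) ^+ 2 / 2 = dl * (20000 * dl) by field.
    rewrite -[dl * mu * _]mulrA ler_pM2l //.
    have : mu * eta <= mu by rewrite ler_piMr // ltW.
    by move: dl_mu mu0; clear; lra.
  rewrite normrM gtr0_norm // ler_pM2l // in h1.
  have h2 : `|- dot p0 q| <= 1 / 2 by rewrite normrN; apply: le_trans t1.
  by rewrite /y dotBr; apply: le_trans (normD_le h1 h2) _; clear; lra.
(* The weight [1 - dot (w j) p0 ^ 2] is the indicator of the lines orthogonal to [p0]. *)
have onY : \sum_j (1 - dot (w j) p0 ^+ 2) * dot (w j) y ^+ 2 =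
    m%:R * (2 * dot y y - 6 * dot p0 y ^+ 2).
  transitivity (\sum_j dot (w j) y * dot (w j) y -
      \sum_j dot (w j) p0 * dot (w j) p0 * (dot (w j) y * dot (w j) y)).
    by rewrite -sumrB; apply: eq_bigr => j _; ring.
  by rewrite (design4 D) (design2 D) p0p0; field.
have yy : dot y y <= 150 ^+ 2.
  have : \sum_j (1 - dot (w j) p0 ^+ 2) * dot (w j) y ^+ 2 <= 3 * m%:R * (118 ^+ 2).
    apply: le_trans (ler_norm _) _; apply: (norm_sum_le D) => [j|];
      last exact: sqr_ge0.
    case: (pm1_sqr (p0E j)) => [u0|->]; last by rewrite subrr mul0r normr0 sqr_ge0.
    rewrite u0 expr0n subr0 mul1r normrX ler_pXn2r ?nnegrE //.
    have -> : dot (w j) y = kap j + - (kap j - dot (w j) y) by ring.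
    apply: le_trans (normD_le (kap_le j) (_ : _ <= eta)) _.
      by rewrite normrN kapY.
    by move: eta1; clear; lra.
  rewrite onY mulrAC mulrC ler_pM2r //.
  have : dot p0 y ^+ 2 <= 1 by rewrite -[1](expr1n _ 2) -real_normK ?num_real //
    ler_pXn2r ?nnegrE.
  by clear; lra.
have Y_le j : `|dot (w j) y| <= 5 * 150 by apply: (dot_le _ D yy); clear; lra.
have kap_on j : `|dot (w j) p0 * (dot (w j) p0 * (dot (w j) q ^+ 2 - 1) *
    ((dot (w j) q + ep * dot (w j) r) * dot (w j) y))| <=
      1 * (eta * (6 * (5 * 150))).
  apply: normM_le; first exact: pm1_le.
  apply: normM_le; first by apply: norm_sqr_le (on j); rewrite ltW.
  apply: normM_le => //.
  have e1 : `|ep| <= 1 / 100 by rewrite gtr0_norm.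
  apply: le_trans (normD_le (w5 _ j qq) (normM_le e1 (w5 _ j rr))) _.
  by clear; lra.
have kapYsum : \sum_j (1 - dot (w j) p0 ^+ 2) * (kap j * dot (w j) y) <=
    m%:R * (14000 * eta).
  have -> : \sum_j (1 - dot (w j) p0 ^+ 2) * (kap j * dot (w j) y) =
      m%:R * (18 * (dot p0 q * dot p0 y)) +
      \sum_j - (dot (w j) p0 * (dot (w j) p0 * (dot (w j) q ^+ 2 - 1) *
         ((dot (w j) q + ep * dot (w j) r) * dot (w j) y))).
    (* Where [p0] does not vanish, [kap] is written as [(S ^ 2 - 1) * (S + ep * X) - 3 * S]. The
       multiples [9 - 12 + 3] of [m * dot q y] cancel, and so do the terms in [dot r y]. *)
    transitivity (\sum_j dot (w j) q * dot (w j) q * (dot (w j) q * dot (w j) y) -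
        4 * \sum_j dot (w j) q * dot (w j) y +
        ep * (\sum_j dot (w j) q * dot (w j) q * (dot (w j) r * dot (w j) y) -
              \sum_j dot (w j) r * dot (w j) y) +
        3 * (\sum_j dot (w j) p0 * dot (w j) p0 * (dot (w j) q * dot (w j) y)) +
        \sum_j - (dot (w j) p0 * (dot (w j) p0 * (dot (w j) q ^+ 2 - 1) *
         ((dot (w j) q + ep * dot (w j) r) * dot (w j) y)))).
      rewrite -sumrB !mulr_sumr -sumrB -!big_split; apply: eq_bigr => j _.
      by rewrite /kap /level3 /=; ring.
    by congr (_ + _); rewrite !(design4 D) !(design2 D) qq p0p0 qr; field.
  have e18 : `|18 : R| <= 18 by rewrite ger0_norm.
  have eN : `|m%:R : R| <= m%:R by rewrite ger0_norm // ltW.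
  have h1 := normM_le eN (normM_le e18 (normM_le p0q p0y)).
  have {}kap_on j : `|- (dot (w j) p0 * (dot (w j) p0 * (dot (w j) q ^+ 2 - 1) *
      ((dot (w j) q + ep * dot (w j) r) * dot (w j) y)))| <= 4500 * eta.
    by rewrite normrN; apply: le_trans (kap_on j) _; clear; lra.
  have eta_ge : 0 <= 4500 * eta by move: eta0; clear; lra.
  have h2 := norm_sum_le D kap_on eta_ge.
  apply: le_trans (ler_norm _) _; apply: le_trans (normD_le h1 h2) _.
  have -> : m%:R * (18 * (200 * dl * 1)) + 3 * m%:R * (4500 * eta) =
      m%:R * (3600 * dl + 13500 * eta) by ring.
  rewrite (ler_pM2l N0).
  have : mu * eta <= eta by rewrite ler_piMl // ltW.
  by move: dl_mu eta0; clear; lra.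
apply: norm_sqr_le => //; rewrite -/(kap i).
apply: le_trans (_ : m%:R * (14400 * eta) <= _); last first.
  apply: le_trans eta_th; have : m%:R * eta <=
    100 * eta by exact: ler_wpM2r (ltW eta0) _ _ N100.
  by move: eta0; clear; lra.
apply: (@le_trans _ _ (\sum_j (1 - dot (w j) p0 ^+ 2) * kap j ^+ 2)).
  rewrite (bigD1 i) //= wi0 expr0n subr0 mul1r lerDl sumr_ge0 // => j _.
  case: (pm1_sqr (p0E j)) => [->|->]; last by rewrite subrr mul0r.
  by rewrite expr0n subr0 mul1r sqr_ge0.
have -> : \sum_j (1 - dot (w j) p0 ^+ 2) * kap j ^+ 2 =
   \sum_j (1 - dot (w j) p0 ^+ 2) * (kap j * dot (w j) y) +
   \sum_j (1 - dot (w j) p0 ^+ 2) * (kap j * (kap j - dot (w j) y)).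
  by rewrite -big_split; apply: eq_bigr => j _ /=; ring.
have eta_ge : 0 <= 117 * eta by move: eta0; clear; lra.
have h j : `|(1 - dot (w j) p0 ^+ 2) * (kap j * (kap j - dot (w j) y))| <=
  117 * eta.
  case: (pm1_sqr (p0E j)) => [u0|->]; last by rewrite subrr mul0r normr0.
  by rewrite u0 expr0n subr0 mul1r; apply: normM_le (kapY j u0).
have := norm_sum_le D h eta_ge; rewrite ler_norml => /andP[_ h1].
apply: le_trans (lerD kapYsum h1) _.
have -> : m%:R * (14000 * eta) + 3 * m%:R * (117 * eta) = m%:R * (14351 * eta) by
  ring.
by rewrite (ler_pM2l N0); move: eta0; clear; lra.
Qed.

(** * Choice of the parameters and the contradiction *)

Lemma exists_scaled (R : realType) (a x : R) : 0 < a -> 0 < x -> exists2 y,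
  0 < y & a * y = x.
Proof.
by move=> a0 x0; exists (x / a); rewrite ?divr_gt0 // mulrC divfK ?lt0r_neq0.
Qed.

(** Chosen in the order [ep], [th], [eta], [mu], [dl], each small in terms of the previous ones. *)
Lemma parameters_exist (R : realType) : exists dl mu ep eta th : R,
  [/\ 0 < dl, 0 < mu, 0 < ep, 0 < eta & 0 <= th] /\
  [/\ 5000 * ep <= 1, 20 * (th + 400 * 1000 * eta) <= ep,
    2 * 1000 * 1000 * eta <= th ^+ 2,
      4 * 1000 * 1000 * mu <= eta ^+ 2 & 10 * 1000 * 1000 * 1000 * dl <= mu * eta].
Proof.
have [|//|ep ep0 epE] := @exists_scaled R 5000 1; first by clear; lra.
have [|//|th th0 thE] := @exists_scaled R 100 ep; first by clear; lra.
have [||eta eta0 etaE] := @exists_scaled R (2 * 1000 * 1000) (th ^+ 2).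
- by clear; lra.
- exact: exprn_gt0.
have [||mu mu0 muE] := @exists_scaled R (4 * 1000 * 1000) (eta ^+ 2).
- by clear; lra.
- exact: exprn_gt0.
have [||dl dl0 dlE] := @exists_scaled R (10 * 1000 * 1000 * 1000) (mu * eta).
- by clear; lra.
- exact: mulr_gt0.
exists dl, mu, ep, eta, th; rewrite etaE muE dlE epE; split; split=> //.
  exact: ltW.
have th1 : th <= 1 by move: epE thE; clear; lra.
by move: th0 th1 eta0 etaE thE; clear; nra.
Qed.

(** The squares of [X] over the lines orthogonal to [p0] sum to nearly [2 * m] by the moments, but
    to at most [3 * m / 100] by the estimates. The parameters precede [p], [q], [r] because the form
    is fixed before the covering copy is known. *)
Lemma level1_nonzero (R : realType) d m (I : finType) (w : I -> 'cV[R]_d) :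
  integral_design m w -> exists2 c : R * R * R, 0 < c.1.1 /\ 0 < c.1.2 /\ 0 < c.2 &
  forall p q r, dot p p = 1 / 3 -> dot q q = 1 -> dot p q = 0 -> dot r r = 1 ->
    dot p r = 0 -> dot q r = 0 ->
  ~ forall i, level1 c.1.1 c.1.2 c.2 (dot (w i) p) (dot (w i) q) (dot (w i) r) = 0.
Proof.
move=> D; have [dl [mu [ep [eta [th [[dl0 mu0 ep0 eta0 th0] [ep5 final eta_th
  mu_eta dl_mu]]]]]]] :=
  parameters_exist R.
exists (dl, mu, ep) => // p q r pp qq pq rr pr qr /= E.
have /andP[N1 N100] := design_scale D.
have ep_le : ep <= 1 / 100 by move: ep5 ep0; clear; lra.
have th1 : 1000 * th <= 1 by move: ep5 final eta0 th0; clear; lra.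
have eta1' : 1000 * 1000 * eta <= 1 by move: ep5 final eta0 th0; clear; lra.
have eta1 : eta <= 1 by move: eta1' eta0; clear; lra.
have mu1 : mu <= 1 / 10 by move: mu_eta eta1 eta0 mu0; clear; nra.
have w5 x j : dot x x = 1 -> `|dot (w j) x| <= 5.
  move=> xx; rewrite -[5]mulr1; apply: (dot_le _ D) => //.
  by rewrite xx expr1n.
have T3 j : `|dot (w j) p| <= 3.
  have h : dot p p <= (3 / 5) ^+ 2 by rewrite pp; clear; lra.
  by apply: le_trans (dot_le j D h _) _; clear; lra.
have Tu j := level1_zero dl0 mu0 mu1 ep0 ep_le (T3 j) (w5 _ j qq) (w5 _ j rr) (E j).
have mueta : mu * eta <= 1 by move: mu1 mu0 eta1 eta0; clear; nra.
have dl_small : 10 * 1000 * 1000 * dl <= 1 by move: dl_mu mueta dl0; clear; lra.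
have [p0 [p0E pp0 e_le p0p0]] := exists_axis D dl0 dl_small pp Tu.
have on := on_axis D dl0 mu0 ep0 ep_le eta0 eta1 mu_eta dl_mu qq pq rr p0E pp0
  e_le p0p0 E.
have mu1' : mu <= 1 by move: mu1; clear; lra.
have off := off_axis_level3 D dl0 mu0 mu1' ep0 ep_le eta0 eta1 dl_mu th0 eta_th
  pp qq pq rr qr p0E pp0 e_le p0p0 E on.
have X_small j : dot (w j) p0 = 0 -> `|dot (w j) r| <= 1 / 10.
  move=> wj0; have [k kZ Sk] := off_axis_int D (ltW eta0) p0p0 p0E on wj0.
  apply: (level3_off ep0 N1 (natr_int _ _) N100 kZ Sk (ltW eta0)) (off j wj0) _ _
    _ _ => //.
    exact: w5.
  exact: w5.
have p0r : dot p0 r ^+ 2 <= 1 / 100.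
  have -> : dot p0 r = - dot (p - p0) r by rewrite dotBl pr; ring.
  rewrite sqrrN; apply: le_trans (dot_CauchySchwarz _ _) _.
  by rewrite rr mulr1; apply: le_trans e_le _; move: dl0 dl_small; clear; nra.
have : \sum_j (1 - dot (w j) p0 ^+ 2) * dot (w j) r ^+ 2 <= 3 * m%:R * (1 / 100).
  apply: le_trans (ler_norm _) _; apply: (norm_sum_le D) => [j|]; last by clear;
    lra.
  case: (pm1_sqr (p0E j)) => [u0|->].
    rewrite u0 expr0n subr0 mul1r (_ : 1 / 100 = 1 / 10 * (1 / 10)); last by field.
    by rewrite expr2; apply: normM_le; exact: X_small.
  by rewrite subrr mul0r normr0; clear; lra.
have -> : \sum_j (1 - dot (w j) p0 ^+ 2) * dot (w j) r ^+ 2 =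
    m%:R * (2 - 6 * dot p0 r ^+ 2).
  transitivity (\sum_j dot (w j) r * dot (w j) r -
      \sum_j dot (w j) p0 * dot (w j) p0 * (dot (w j) r * dot (w j) r)).
    by rewrite -sumrB; apply: eq_bigr => j _; ring.
  by rewrite (design4 D) (design2 D) p0p0 rr; field.
by move: p0r N1; move: (_ ^+ 2) (m%:R : R); clear=> a N h1 h2; nra.
Qed.

(** * Covers and designs *)

Section CubicEval.
Variables (R : realType) (d : nat).

Lemma cubicD (c c' : 'M[R]_d) x : cubic (c + c') x = cubic c x + cubic c' x.
Proof.
rewrite /cubic -big_split; apply: eq_bigr => i _; rewrite -big_split.
by apply: eq_bigr => j _; rewrite mxE mulrDl.
Qed.

Lemma cubic_coef (a : R) (c : 'M[R]_d) x : cubic (a *: c) x = a * cubic c x.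
Proof.
rewrite /cubic mulr_sumr; apply: eq_bigr => i _; rewrite mulr_sumr.
by apply: eq_bigr => j _; rewrite mxE -mulrA.
Qed.

Lemma cubic_delta i j (x : 'cV[R]_d) :
  cubic (delta_mx i j) x = x i 0 * x j 0 ^+ 2.
Proof.
rewrite /cubic (bigD1 i) //= [X in _ + X]big1 ?addr0 => [|k /negbTE ki]; last first.
  by rewrite big1 // => l _; rewrite mxE ki /= mul0r.
rewrite (bigD1 j) //= big1 => [|l /negbTE lj]; last by rewrite mxE lj andbF mul0r.
by rewrite addr0 mxE !eqxx mul1r.
Qed.

End CubicEval.

(** The form is [c0 x_0 ^ 3 + c1 x_0 x_1 ^ 2 + c2 x_1 ^ 3 + c3 x_2 x_1 ^ 2], and [x], [y], [z] are
    the first three coordinate vectors pulled back by the rotation. *)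
Lemma cover_design (R : realType) d (I : finType) (w : I -> 'cV[R]_d.+3) V
    (K s D c0 c1 c2 c3 : R) :
  K != 0 -> s != 0 -> (forall i, V (s *: w i)) ->
  (forall i, dot (w i) (w i) = D) ->
  (forall x y, \sum_i dot (w i) x * dot (w i) y = K * dot x y) ->
  (forall x y z t, \sum_i dot (w i) x * dot (w i) y * (dot (w i) z * dot (w i) t) =
    K * (dot x y * dot z t + dot x z * dot y t + dot x t * dot y z)) ->
  universal_cover (circumscribed V) ->
  exists x y z : 'cV[R]_d.+3, [/\ [/\ dot x x = 1, dot y y = 1 & dot z z = 1],
    [/\ dot x y = 0, dot x z = 0 & dot y z = 0] &
    forall i, c0 * (dot (w i) x ^+ 3 - 3 * dot (w i) x) +
      c1 * (dot (w i) x * (dot (w i) y ^+ 2 - 1)) +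
      c2 * (dot (w i) y ^+ 3 - 3 * dot (w i) y) +
      c3 * ((dot (w i) y ^+ 2 - 1) * dot (w i) z) = 0].
Proof.
move=> K0 s0 Vw wD des2 des4 cover.
pose i0 : 'I_d.+3 := inord 0; pose i1 : 'I_d.+3 := inord 1;
  pose i2 : 'I_d.+3 := inord 2.
pose c := c0 *: delta_mx i0 i0 + c1 *: delta_mx i0 i1 + c2 *: delta_mx i1 i1 +
  c3 *: delta_mx i2 i1.
have [A [b [AA fA]]] := cover_cubic c cover.
pose e i : 'cV[R]_d.+3 := A^T *m delta_mx i 0.
have ee i j : dot (e i) (e j) = (i == j)%:R.
  rewrite dot_orthogonal; last by rewrite /Defs.orthogonal trmxK; apply: mulmx1C.
  by rewrite dot_delta mxE eqxx andbT eq_sym.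
have i01 : i0 != i1 by rewrite -val_eqE /= !inordK.
have i02 : i0 != i2 by rewrite -val_eqE /= !inordK.
have i12 : i1 != i2 by rewrite -val_eqE /= !inordK.
exists (e i0), (e i1), (e i2); rewrite !ee !eqxx (negbTE i01) (negbTE i02) (negbTE
  i12).
split=> //.
have coord i u : (A *m u) i 0 = dot u (e i) by rewrite -dot_mulmx dot_delta.
have {}fA i : c0 * (dot (w i) (e i0) * (dot (w i) (e i0)) ^+ 2) +
    c1 * (dot (w i) (e i0) * dot (w i) (e i1) ^+ 2) +
    c2 * (dot (w i) (e i1) * dot (w i) (e i1) ^+ 2) +
    c3 * (dot (w i) (e i2) * dot (w i) (e i1) ^+ 2) = dot (w i) (D *: b).
  have := fA _ (Vw i); rewrite -scalemxAr cubicZ !dotZl dotZr wD.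
  rewrite !cubicD !cubic_coef !cubic_delta !coord dotZr => h.
  by apply: (mulfI (expf_neq0 3 s0)); rewrite h; ring.
(* The projection of the form onto the linear functionals, read off from the fourth moments; the
   second moments force [D *: b] to equal it. *)
pose b0 := (3 * c0 + c1) *: e i0 + (3 * c2) *: e i1 + c3 *: e i2.
have b0E : D *: b = b0.
  apply/eqP; rewrite -subr_eq0; apply/eqP/dotxx_eq0; set z := _ - b0.
  apply: (mulfI K0); rewrite mulr0 {1}/z dotBl mulrBr -!des2.
  apply/eqP; rewrite subr_eq0; apply/eqP.
  transitivity (c0 * (\sum_i dot (w i) (e i0) * dot (w i) (e i0) * (dot (w i) (e
    i0) * dot (w i) z)) +
     c1 * (\sum_i dot (w i) (e i1) * dot (w i) (e i1) * (dot (w i) (e i0) * dot (w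
       i) z)) +
     c2 * (\sum_i dot (w i) (e i1) * dot (w i) (e i1) * (dot (w i) (e i1) * dot (w
       i) z)) +
     c3 * (\sum_i dot (w i) (e i1) * dot (w i) (e i1) * (dot (w i) (e i2) * dot (w
       i) z))).
    by rewrite !mulr_sumr -!big_split; apply: eq_bigr => i _; rewrite -fA /=; ring.
  rewrite !des4 !ee !eqxx [i1 == i0]eq_sym (negbTE i01) (negbTE i12) des2.
  by rewrite /b0 !(dotDl, dotZl) /=; ring.
by move=> i; move: (fA i); rewrite b0E /b0 !(dotDr, dotZr); clear; lra.
Qed.

(** The dimension is [d + 3] and [k ^ 2] is the dimension plus 2. An integer [k] makes the Gram
    matrix integral, and [m] is a third of the total mass. *)
Lemma equiangular_not_cover (R : realType) d (I : finType) (w : I -> 'cV[R]_d.+3)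
    V (k m : nat) (s : R) :
  (k ^ 2 = d + 5)%N -> (k <= 5)%N -> (6 * m = d.+4 * d.+4.+1)%N ->
  (#|I| * 2 = d.+3 * d.+4)%N -> s != 0 -> (forall i, V (s *: w i)) ->
  (forall i, dot (w i) (w i) = (k ^ 2)%:R) ->
  (forall i j, i != j -> dot (w i) (w j) = k%:R \/ dot (w i) (w j) = - k%:R) ->
  ~ universal_cover (circumscribed V).
Proof.
move=> k2 k5 m6 cardI s0 Vw wd wij.
have dE : (k ^ 2)%:R = d.+3%:R + 2 :> R by rewrite k2 -natrD; congr _%:R; lia.
have wd' i : dot (w i) (w i) = d.+3%:R + 2 by rewrite wd.
have wij' i j : i != j -> dot (w i) (w j) ^+ 2 = d.+3%:R + 2.
  by move/wij; rewrite -dE natrX => -[] ->; rewrite ?sqrrN.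
have aE : (d.+3%:R + 1) * (d.+3%:R + 2) / 2 = 3 * m%:R :> R.
  have -> : (d.+3%:R + 1) * (d.+3%:R + 2) = 6 * m%:R :> R.
    by rewrite natr1 -natrD -!natrM; congr _%:R; lia.
  by field.
have des2 := equiangular_design2 cardI wd' wij'; rewrite aE in des2.
have des4 := equiangular_design4 cardI wd' wij'; rewrite aE in des4.
have d20 : (d <= 20)%N by move: (leq_sqr k 5); rewrite k5 k2; lia.
have D : integral_design m w.
  split=> //.
  - lia.
  - nia.
  - nia.
  - by move=> i; rewrite wd ler_nat (leq_sqr k 5).
  - move=> i j; have [->|/wij[] ->] := eqVneq i j; first by rewrite wd natr_int.
      by rewrite natr_int.
    by rewrite rpredN natr_int.
have [[[dl mu] ep] _ nz] := level1_nonzero D.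
have m0 : 3 * m%:R != 0 :> R by rewrite -natrM pnatr_eq0; lia.
pose q3 : R := Num.sqrt 3.
have q3E : q3 ^+ 2 = 3 by rewrite sqr_sqrtr.
have q30 : q3 != 0 by apply/eqP => q0; move: q3E; rewrite q0; clear; lra.
(* Scaling the first coordinate by [1 / sqrt 3] turns [x ^ 3 - 3 * x] into the [T ^ 3 - T] of
   [level1]. *)
move=> /(cover_design (q3^-1 ^+ 3) (dl / q3) (dl * mu) (dl * mu * ep) m0 s0 Vw wd
  des2 des4).
case=> x [y [z [[xx yy zz] [xy xz yz] E]]].
apply: (nz (q3^-1 *: x) y z) => //; rewrite ?dotZl ?dotZr ?xx ?xy ?xz ?mulr0 //.
  by rewrite mulr1 -expr2 exprVn q3E div1r.
move=> i /=; rewrite -[RHS](E i) /level1 /level3 dotZr.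
have -> : q3^-1 ^+ 3 * (dot (w i) x ^+ 3 - 3 * dot (w i) x) =
   (q3^-1 * dot (w i) x) ^+ 3 - q3^-1 * dot (w i) x by rewrite -q3E; field.
by field.
Qed.

Lemma regular_icosahedron_not_cover (R : realType) (V : set 'cV[R]_3) :
  regular_icosahedron V -> ~ universal_cover (circumscribed V).
Proof.
move=> [c [A [c0 AA ->]]] cover.
pose phi : R := (1 + Num.sqrt 5) / 2.
have phi2 : phi ^+ 2 = phi + 1.
  have : Num.sqrt 5 ^+ 2 = 5 :> R by rewrite sqr_sqrtr.
  rewrite /phi; move: (Num.sqrt 5); clear=> q q2.
  have -> : ((1 + q) / 2) ^+ 2 = (1 + 2 * q + q ^+ 2) / 4 by field.
  by rewrite q2; field.
have phi1 : 1 <= phi.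
  have : 1 <= Num.sqrt 5 :> R by rewrite -[leLHS]sqrtr1 ler_sqrt ?ler1n // ltr0n.
  by rewrite /phi; move: (Num.sqrt 5); clear=> q; lra.
(* One vertex out of each of the six antipodal pairs. *)
pose v (ib : 'I_3 * bool) : 'cV[R]_3 :=
  \col_j (if j == ib.1 then 0 else if j == ib.1 + 1 then 1 else (-1) ^+ ib.2 * phi).
have neq3 (i : 'I_3) : [/\ (i + 1 == i) = false, (i + 2 == i) = false &
    (i + 2 == i + 1) = false] by case: i => [[|[|[|//]]] ?].
have Vv ib : icosahedron R (v ib).
  have [h1 h2 h3] := neq3 ib.1; exists ib.1; rewrite !mxE h1 h2 h3 !eqxx normr1.
  by split=> //; rewrite normrM normrX normrN1 expr1n mul1r ger0_norm //; lra.
have dv ib jb : let k := dot (v ib) (v jb) in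
    if ib == jb then k = phi + 2 else k = phi \/ k = - phi.
  case: ib jb => [[[|[|[|//]]] ?] [|]] [[[|[|[|//]]] ?] [|]];
  rewrite /dot !big_ord_recl big_ord0 !mxE /= -?val_eqE /= ?expr0 ?expr1;
  by move: phi2; try lra; (try by left; lra); right; lra.
(* Rescales the squared norm [phi + 2] to 5; the products [phi] and [- phi] then get square 5
   because [(phi + 2) ^ 2 = 5 * phi ^ 2]. *)
pose t : R := Num.sqrt (5 / (phi + 2)).
have t2 : t ^+ 2 = 5 / (phi + 2) by rewrite sqr_sqrtr ?divr_ge0 //; lra.
have phi20 : phi + 2 != 0 by apply/eqP; lra.
have t0 : t != 0.
  apply/eqP => t0; move: t2; rewrite t0 expr0n => /esym/eqP.
  by rewrite mulf_eq0 invr_eq0 (negbTE phi20) orbF pnatr_eq0.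
pose w ib := t *: (A *m v ib).
have dw ib jb : dot (w ib) (w jb) = 5 / (phi + 2) * dot (v ib) (v jb).
  by rewrite dotZl dotZr dot_orthogonal // mulrA -expr2 t2.
have ww ib : dot (w ib) (w ib) = 3%:R + 2.
  by rewrite dw; have := dv ib ib; rewrite eqxx /= => ->; rewrite divfK // -natrD.
have ww' ib jb : ib != jb -> dot (w ib) (w jb) ^+ 2 = 3%:R + 2.
  move=> /negbTE ij; rewrite dw; have := dv ib jb; rewrite ij /= => k_phi.
  have -> : (5 / (phi + 2) * dot (v ib) (v jb)) ^+ 2 =
      25 * phi ^+ 2 / (phi + 2) ^+ 2 by case: k_phi => ->; field.
  have -> : (phi + 2) ^+ 2 = 5 * phi ^+ 2 by rewrite sqrrD phi2; ring.
  have phi0 : phi != 0 by apply/eqP; lra.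
  by field.
have cardI : (#|{: 'I_3 * bool}| * 2 = 3 * 4)%N by rewrite card_prod card_ord
  card_bool.
have des2 := equiangular_design2 cardI ww ww'.
have des4 := equiangular_design4 cardI ww ww'.
have Vw ib : [set c *: (A *m p) | p in icosahedron R] ((c / t) *: w ib).
  by exists (v ib); rewrite // /w scalerA divfK.
have K0 : (3%:R + 1) * (3%:R + 2) / 2 != 0 :> R by apply/eqP; lra.
have s0 : c / t != 0 by rewrite mulf_neq0 ?invr_eq0 // lt0r_neq0.
have [x [y [z [[xx _ _] _ E]]]] := cover_design 1 0 0 0 K0 s0 Vw ww des2 des4 cover.
have x2 ib : dot (w ib) x * dot (w ib) x = 3 * (dot (w ib) x != 0)%:R.
  have [->|x0] := eqVneq (dot (w ib) x) 0; first by rewrite !mulr0.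
  by apply: (mulIf x0); rewrite /= mulr1; move: (E ib); clear; lra.
have := des2 x x; under eq_bigr => ib _ do rewrite x2.
rewrite -mulr_sumr -natr_sum xx mulr1; set k := (\sum_i _)%N => h.
have /eqP : (3 * k)%:R = 10%:R :> R by rewrite natrM h; lra.
by rewrite eqr_nat => /eqP; lia.
Qed.

(** * The dual of the 3_21 polytope *)

Lemma dot_col_mx (R : realType) m n (a a' : 'cV[R]_m) (b b' : 'cV[R]_n) :
  dot (col_mx a b) (col_mx a' b') = dot a a' + dot b b'.
Proof.
rewrite {1}/dot big_split_ord; congr (_ + _); apply: eq_bigr => i _.
  by rewrite !col_mxEu.
by rewrite !col_mxEd.
Qed.

(** Adding the unit vector along [x] as a first row completes [B] to an orthogonal matrix, and the
    new coordinate vanishes at [v']. *)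
Lemma dot_perp_isometry (R : realType) d (x : 'cV[R]_d.+1) (B : 'M[R]_(d,
  d.+1)) v v' :
  perp_isometry x B -> x != 0 -> dot v' x = 0 -> dot (B *m v) (B *m v') = dot v v'.
Proof.
case=> BB Bx x0 v'x.
have nx : enorm x != 0.
  by apply: contra_neq x0 => h; apply: dotxx_eq0; rewrite -enorm_sqr h expr0n.
have mul_dot (a b : 'cV[R]_d.+1) : a^T *m b = (dot a b)%:M.
  apply/matrixP => i j; rewrite !ord1 !mxE; apply: eq_bigr => k _.
  by rewrite !mxE.
pose y := (enorm x)^-1 *: x.
have By : B *m y = 0 by rewrite -scalemxAr Bx scaler0.
have yy : y^T *m y = 1%:M.
  by rewrite mul_dot dotZl dotZr -enorm_sqr; congr _%:M; field.
pose H : 'M[R]_(1 + d) := col_mx y^T B.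
have HH : H *m H^T = 1%:M.
  rewrite /H tr_col_mx mul_col_row BB trmxK yy By -trmx_mul By trmx0.
  by rewrite -scalar_mx_block.
have HTH : Defs.orthogonal H by apply: mulmx1C.
have yv' : y^T *m v' = 0.
  by rewrite mul_dot dotZl (dotC x) v'x mulr0 raddf0.
have := dot_orthogonal (v : 'cV_(1 + d)) (v' : 'cV_(1 + d)) HTH.
by rewrite {1 2}/H !mul_col_mx dot_col_mx yv' (dotC _ 0) dot0l add0r.
Qed.

Section Dual321.
Variable R : realType.

Lemma dot_u8_delta (i : 'I_8) : dot (u8 R) (delta_mx i 0) = 1.
Proof. by rewrite dot_delta mxE. Qed.

Lemma dot_delta_delta (i j : 'I_8) :
  dot (delta_mx i 0 : 'cV[R]_8) (delta_mx j 0) = (i == j)%:R.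
Proof. by rewrite dot_delta mxE eqxx andbT eq_sym. Qed.

Lemma dot_u8 : dot (u8 R) (u8 R) = 8.
Proof.
rewrite /dot (eq_bigr (fun=> 1)) ?sumr_const ?card_ord // => i _.
by rewrite mxE mulr1.
Qed.

Lemma dot_v8_u8 i j : dot (v8 R i j) (u8 R) = 0.
Proof.
by rewrite dotBl dotZl dotDl !(dotC _ (u8 R)) !dot_u8_delta dot_u8; ring.
Qed.

Lemma dot_v8 i j k l : dot (v8 R i j) (v8 R k l) =
  - 8 + 16 * ((i == k) + (i == l) + (j == k) + (j == l))%:R.
Proof.
rewrite {2}/v8 dotBr dot_v8_u8 dotZr dotDr !dotBl !dot_u8_delta !dotZl !dotDl.
by rewrite !dot_delta_delta !natrD; ring.
Qed.

Lemma dual321_not_cover (B : 'M[R]_(7, 8)) : perp_isometry (u8 R) B ->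
  ~ universal_cover (circumscribed [set B *m v | v in axes321 R]).
Proof.
move=> BP; pose I := {ij : 'I_8 * 'I_8 | (ij.1 < ij.2)%N}.
(* Brings the squared norm 24 to [9 = 7 + 2], and the products 8 and -8 to 3 and -3. *)
pose s : R := Num.sqrt (8 / 3).
have s2 : s ^+ 2 = 8 / 3 by rewrite sqr_sqrtr // divr_ge0.
have s0 : s != 0.
  by apply/eqP => h; move: s2; rewrite h; clear; lra.
pose w (ij : I) := s^-1 *: (B *m v8 R (val ij).1 (val ij).2).
have u0 : u8 R != 0.
  by apply/eqP => h; move: dot_u8; rewrite h dot0l; clear; lra.
have dw (a b : I) : dot (w a) (w b) =
    3 / 8 * dot (v8 R (val a).1 (val a).2) (v8 R (val b).1 (val b).2).
  rewrite dotZl dotZr (dot_perp_isometry _ BP u0) ?dot_v8_u8 // mulrA -expr2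
    exprVn s2.
  by congr (_ * _); field.
apply: (@equiangular_not_cover R 4 I w _ 3 12 s) => //.
- by rewrite card_sig card_pairs_ltn.
- move=> ij; exists (v8 R (val ij).1 (val ij).2); first by exists (val ij) => //;
  exact: (svalP ij).
  by rewrite /w scalerA divff // scale1r.
- move=> [[i j] ij]; have /negbTE ne : i != j by rewrite -val_eqE neq_ltn ij.
  by rewrite dw dot_v8 /= !eqxx (eq_sym j) ne /=; field.
move=> [[i j] ij] [[k l] kl]; rewrite -val_eqE /= xpair_eqE => ne;
  rewrite dw dot_v8 /=.
set n := (_ + _ + _ + _)%N; have n1 : (n <= 1)%N.
  by move: ij kl ne; rewrite /n -!val_eqE /=; lia.
by case: n n1 => [|[|//]] _; [right | left]; field.
Qed.

End Dual321.

(** * The orbit of 552 vectors *)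

Definition golay_row (i : nat) : seq bool :=
  [seq if (j == 23)%N then true
    else (i <= j)%N && ((j - i)%N \in [:: 0; 2; 4; 5; 6; 10;
      11]%N) | j <- iota 0 24].

Definition xor_word (l l' : seq bool) : seq bool :=
  [seq p.1 (+) p.2 | p <- zip l l'].

(** All sums of the rows of [golay_gen], as lists, so that the code can be enumerated by
    computation. *)
Definition golay_words : seq (seq bool) :=
  foldr (fun i ws => ws ++ [seq xor_word (golay_row i) l | l <- ws])
    [:: nseq 24 false] (iota 0 12).

Definition octads : seq (seq bool) :=
  [seq l <- golay_words | head false l && (count id l == 8)%N].

(* [sqrt 2] times the minimal vectors [u] of the Leech lattice with [<u, x> = 3],
   one out of each pair [{u, x - u}]: the octads through the coordinate 0, and
   the vectors [2 (e_0 + e_j)]. *)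
Definition half_vectors : seq (seq nat) :=
  [seq [seq (if (i == 0) || (i == j) then 2 else 0)%N | i <- iota 0 24]
    | j <- iota 1 23] ++
  [seq [seq nat_of_bool b | b <- l] | l <- octads].

Definition seq_dot (l l' : seq nat) : nat :=
  sumn [seq (p.1 * p.2)%N | p <- zip l l'].

Lemma half_vectors_size : size half_vectors == 276%N.
Proof. by vm_compute. Qed.

(** The numbers 8 and 12 encode [|u| ^ 2 = 4] and [<u, x> = 3]. *)
Lemma half_vectors_self :
  all (fun l => [&& size l == 24, seq_dot l l == 8 & 4 * head 0 l + sumn l == 12])%N
    half_vectors.
Proof. by vm_compute. Qed.

(** Equiangularity: the products [<u, u'>] are 1 or 2, and projecting along [x] subtracts
    [3 / 2]. *)
Lemma half_vectors_pair :
  pairwise (fun l l' => seq_dot l l' \in [:: 2; 4]%N) half_vectors.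
Proof. by vm_compute. Qed.

Definition word_vector (l : seq bool) : 'rV['F_2]_24 := \row_j (nth false l j)%:R.

Lemma word_vector0 : word_vector (nseq 24 false) = 0.
Proof. by apply/rowP => j; rewrite !mxE nth_nseq if_same. Qed.

Lemma word_vector_xor l l' : size l = 24%N -> size l' = 24%N ->
  word_vector (xor_word l l') = word_vector l + word_vector l'.
Proof.
move=> sl sl'; apply/rowP => j; rewrite !mxE (nth_map (false, false)); last first.
  by rewrite size_zip sl sl' minnn.
rewrite nth_zip ?sl ?sl' //=.
by case: (nth _ _ _); case: (nth _ _ _); apply/val_inj.
Qed.

Lemma golay_words_golay l : l \in golay_words ->
  size l = 24%N /\ golay (word_vector l).
Proof.
have : all (fun i => i < 12)%N (iota 0 12) by [].
rewrite /golay_words; elim: (iota 0 12) l => [|i s IHs] l /=.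
  move=> _; rewrite inE => /eqP ->; split=> //.
  by rewrite (word_vector0 : word_vector _ = _) /golay sub0mx.
case/andP=> i12 /IHs {}IHs; rewrite mem_cat => /orP[/IHs //|].
case/mapP => l' /IHs [sl' gl'] ->.
have si : size (golay_row i) = 24%N by rewrite size_map size_iota.
split; first by rewrite size_map size_zip si sl'.
rewrite word_vector_xor // /golay addmx_sub //.
rewrite (_ : word_vector _ = row (Ordinal i12) golay_gen) ?row_sub //.
apply/rowP => j; rewrite !mxE (nth_map 0%N) ?size_iota // nth_iota //.
Qed.

(** * Minimal vectors of the Leech lattice and their projections *)

Section Leech.
Variable R : realType.

Definition nat_vector (l : seq nat) : 'cV[R]_24 := \col_i (nth 0%N l i)%:R.

Lemma nat_vector_dot l l' : size l = 24%N -> size l' = 24%N ->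
  dot (nat_vector l) (nat_vector l') = (seq_dot l l')%:R.
Proof.
move=> sl sl'; rewrite /seq_dot sumnE big_map natr_sum (big_nth (0,
  0)%N) size_zip sl sl'.
by rewrite big_mkord; apply: eq_bigr => i _;
  rewrite !mxE nth_zip ?sl ?sl' //= natrM.
Qed.

Definition leech_vector (l : seq nat) : 'cV[R]_24 :=
  (Num.sqrt 8)^-1 *: (2 *: nat_vector l).

Lemma sqrt8_sqr : (Num.sqrt 8)^-1 * (Num.sqrt 8)^-1 = 8^-1 :> R.
Proof. by rewrite -expr2 exprVn sqr_sqrtr. Qed.

Lemma dot_leech_vector l l' : size l = 24%N -> size l' = 24%N ->
  dot (leech_vector l) (leech_vector l') = (seq_dot l l')%:R / 2.
Proof.
move=> sl sl'; rewrite !(dotZl, dotZr) nat_vector_dot // mulrCA !mulrA.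
by rewrite -[2 * _ * _]mulrA sqrt8_sqr; field.
Qed.

Lemma dot_leech_vector_x24 l : size l = 24%N ->
  dot (leech_vector l) (x24 R) = (4 * head 0%N l + sumn l)%:R / 4.
Proof.
move=> sl; have -> : dot (leech_vector l) (x24 R) =
    4^-1 * dot (nat_vector l) (4 *: delta_mx ord0 0 + const_mx 1).
  by rewrite !(dotZl, dotZr) !mulrA [_ * 2]mulrC -(mulrA 2) sqrt8_sqr; field.
rewrite dotDr dotZr dot_delta mxE nth0 natrD natrM mulrC; congr ((_ + _) / _).
rewrite sumnE natr_sum (big_nth 0%N) sl big_mkord; apply: eq_bigr => i _.
by rewrite !mxE mulr1.
Qed.

Lemma dot_x24 : dot (x24 R) (x24 R) = 6.
Proof.
have -> : dot (x24 R) (x24 R) = 8^-1 * (16 * dot (delta_mx ord0 0 : 'cV[R]_24)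
  (delta_mx ord0 0)
    + 8 * dot (const_mx 1 : 'cV[R]_24) (delta_mx ord0 0)
    + dot (const_mx 1 : 'cV[R]_24) (const_mx 1)).
  rewrite /x24 !(dotZl, dotZr, dotDl, dotDr) (dotC (delta_mx _ _) (const_mx _)).
  by rewrite mulrA sqrt8_sqr; ring.
rewrite !dot_delta !mxE !eqxx /dot (eq_bigr (fun=> 1)) ?sumr_const ?card_ord.
  by rewrite /=; field.
by move=> i _; rewrite mxE mulr1.
Qed.

Lemma half_vectors_leech l : l \in half_vectors -> leech R (leech_vector l).
Proof.
rewrite mem_cat => /orP[] /mapP[].
  move=> j; rewrite mem_iota => /andP[j0 j24] ->.
  pose k : 'I_24 := Ordinal j24.
  exists false, 0, (delta_mx ord0 0 + delta_mx k 0); split.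
  - by rewrite /golay sub0mx.
  - have sum_delta (i : 'I_24) : \sum_n (delta_mx i 0 : 'cV[int]_24) n 0 = 1.
      rewrite (bigD1 i) //= big1 => [|n /negbTE ni]; last by rewrite mxE ni.
      by rewrite mxE !eqxx.
    under eq_bigr => n _ do rewrite mxE.
    by rewrite big_split /= !sum_delta.
  congr (_ *: _); apply/colP => i; rewrite !mxE.
  rewrite (nth_map 0%N) ?size_iota // nth_iota // add0n !andbT -!val_eqE /=.
  have [->|_] := eqVneq (val i) 0%N; first by rewrite (ltn_eqF j0) /=; ring.
  by case: eqP => _ /=; ring.
move=> b; rewrite mem_filter => /andP[_ /golay_words_golay [sb gb]] ->.
exists false, (word_vector b), 0; split=> //.
  by rewrite big1 // => i _; rewrite mxE.
congr (_ *: _); apply/colP => i; rewrite !mxE (nth_map false) ?sb //.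
rewrite mulr0 add0r addr0; congr (_ * _%:R).
by case: (nth _ _ _).
Qed.

Lemma seq_dotC l l' : seq_dot l l' = seq_dot l' l.
Proof.
rewrite /seq_dot; congr sumn; elim: l l' => [|a l IHl] [|b l'] //=.
by rewrite mulnC IHl.
Qed.

Lemma orbit552_equiangular : exists v : 'I_276 -> 'cV[R]_24,
  [/\ forall i, orbit552 R (v i), forall i, dot (v i) (x24 R) = 0,
      forall i, dot (v i) (v i) = 5 / 2 &
      forall i j, i != j -> dot (v i) (v j) = 1 / 2 \/ dot (v i) (v j) = - (1 / 2)].
Proof.
have := half_vectors_pair; have := half_vectors_self; have := half_vectors_size.
(* The list is abstracted to its verified properties, which keeps it from being unfolded. *)
have := half_vectors_leech; move: half_vectors =>
  h h_leech /eqP h276 /allP h_self /(pairwiseP [::]) h_pair.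
pose l (i : 'I_276) := nth [::] h i.
have lh i : l i \in h by rewrite mem_nth ?h276.
have /all_and3 [l24 l8 l12] i : [/\ size (l i) = 24%N, seq_dot (l i) (l i) = 8%N &
    (4 * head 0 (l i) + sumn (l i) = 12)%N].
  by have /and3P[/eqP ? /eqP ? /eqP] := h_self _ (lh i).
have l_pair i j : i != j -> seq_dot (l i) (l j) \in [:: 2; 4]%N.
  rewrite -val_eqE neq_ltn => /orP[] ij; last rewrite seq_dotC.
    by apply: h_pair; rewrite ?inE ?h276.
  by apply: h_pair; rewrite ?inE ?h276.
have lx i : dot (leech_vector (l i)) (x24 R) = 3.
  by rewrite dot_leech_vector_x24 // l12; field.
pose v i := leech_vector (l i) - 2^-1 *: x24 R.
have vx i : dot (v i) (x24 R) = 0 by rewrite dotBl (dotZl 2^-1) dot_x24 lx; field.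
have vv i j : dot (v i) (v j) = (seq_dot (l i) (l j))%:R / 2 - 3 / 2.
  rewrite {2}/v dotBr (dotZr 2^-1) vx dotBl (dotZl 2^-1).
  by rewrite (dotC (x24 R)) lx dot_leech_vector //; field.
exists v; split=> // [i|i|i j /l_pair].
- exists (leech_vector (l i)) => //; split=> //; first exact: h_leech.
  by rewrite enorm_sqr dot_leech_vector // l8; field.
- by rewrite vv l8; field.
by rewrite vv !inE => /orP[] /eqP ->; [right | left]; field.
Qed.

Lemma orbit552_not_cover (B : 'M[R]_(23, 24)) : perp_isometry (x24 R) B ->
  ~ universal_cover (circumscribed [set B *m v | v in orbit552 R]).
Proof.
move=> BP; have [v [v_orbit vx vv vv']] := orbit552_equiangular.
(* Brings the squared norm [5 / 2] to [25 = 23 + 2]. *)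
pose s : R := Num.sqrt (1 / 10).
have s2 : s ^+ 2 = 1 / 10 by rewrite sqr_sqrtr // divr_ge0.
have s0 : s != 0 by apply/eqP => h; move: s2; rewrite h; clear; lra.
pose w i := s^-1 *: (B *m v i).
have x0 : x24 R != 0.
  by apply/eqP => h; move: dot_x24; rewrite h dot0l; clear; lra.
have dw i j : dot (w i) (w j) = 10 * dot (v i) (v j).
  rewrite dotZl dotZr (dot_perp_isometry _ BP x0) ?vx //.
  by rewrite mulrA -expr2 exprVn s2; field.
apply: (@equiangular_not_cover R 20 _ w _ 5 100 s) => //.
- by rewrite card_ord.
- move=> i; exists (v i); first exact: v_orbit.
  by rewrite /w scalerA divff // scale1r.
- by move=> i; rewrite dw vv; field.
by move=> i j /vv'; rewrite dw => -[] ->; [left | right]; field.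
Qed.

End Leech.

Theorem theorem2 (R : realType) :
  (forall V : set 'cV[R]_3,
     regular_icosahedron V -> ~ universal_cover (circumscribed V)) /\
  (forall B : 'M[R]_(7, 8), perp_isometry (u8 R) B ->
     ~ universal_cover (circumscribed [set B *m v | v in axes321 R])) /\
  (forall B : 'M[R]_(23, 24), perp_isometry (x24 R) B ->
     ~ universal_cover (circumscribed [set B *m v | v in orbit552 R])).
Proof.
split; [exact: regular_icosahedron_not_cover | split].
  exact: dual321_not_cover.
exact: orbit552_not_cover.
Qed.
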